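(* Let $\Omega\subset\mathbb{H}$ be a slice contractible (circular) slice domain and let $g\in\mathcal{R}(\Omega)$ be a never vanishing function such that $g_v$ has a non-real isolated zero. Then at least one of $g$ and $-g$ has no $*$-logarithm.
   Context: $\mathbb{H}$ is the algebra of quaternions; $q=q_0+q_v$ with $q_0$ real and $q_v$ purely imaginary, $q^c=q_0-q_v$, $\mathbb{S}=\{I\in\mathbb{H}: I^2=-1\}$, $\mathbb{C}_I=\mathbb{R}+\mathbb{R}I$, $\mathbb{S}_q=\{q_0+\|q_v\|J: J\in\mathbb{S}\}$, $\Omega_I=\Omega\cap\mathbb{C}_I$. A domain (nonempty connected open set) $\Omega\subset\mathbb{H}$ is circular if $\mathbb{S}_q\subset\Omega$ for all $q\in\Omega$; it is a slice domain if $\Omega\cap\mathbb{R}\neq\emptyset$. A slice domain is slice contractible if, for some (equivalently any) $I\in\mathbb{S}$, $\Omega_I$ is a simply connected domain. A function $f:\Omega\to\mathbb{H}$ is slice regular if $f(\alpha+I\beta)=F_0(\alpha+\sqrt{-1}\beta)+I F_1(\alpha+\sqrt{-1}\beta)$ for all $I\in\mathbb{S}$ and $\alpha,\beta\in\mathbb{R}$ with $\alpha+I\beta\in\Omega$, where $F_0,F_1:\{\alpha+\sqrt{-1}\beta:\alpha+I\beta\in\Omega\}\to\mathbb{H}$ are $C^1$, $F_0(\bar z)=F_0(z)$, $F_1(\bar z)=-F_1(z)$ and $\partial_\alpha F_0=\partial_\beta F_1$, $\partial_\beta F_0=-\partial_\alpha F_1$. $\mathcal{R}(\Omega)$ is the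 set of slice regular functions; $f\in\mathcal{R}(\Omega)$ is slice preserving if $f(\Omega_I)\subset\mathbb{C}_I$ for all $I\in\mathbb{S}$, and $\mathcal{R}_{\mathbb{R}}(\Omega)$ is the set of slice preserving functions. The $*$-product is $(f*g)(q)=0$ if $f(q)=0$, and $(f*g)(q)=f(q)\,g(f(q)^{-1}qf(q))$ otherwise; with pointwise sum it makes $\mathcal{R}(\Omega)$ an associative algebra. The slice conjugate $f^c$ is the function induced by $(F_0^c,F_1^c)$ (pointwise conjugates), and $f^s=f*f^c$. Every $f\in\mathcal{R}(\Omega)$ is uniquely $f=f_0+f_1i+f_2j+f_3k$ with $f_\ell\in\mathcal{R}_{\mathbb{R}}(\Omega)$; $f_0$ is its real part and $f_v=f-f_0$ its vector part. $\exp_*(f)=\sum_{n\ge0}f^{*n}/n!$, with $f^{*n}$ the $n$-th $*$-power. A $*$-logarithm of $g$ is an $f\in\mathcal{R}(\Omega)$ with $\exp_*(f)=g$. Non-real isolated zeroes: let $f\in\mathcal{R}(\Omega)$ with $f^s\not\equiv0$ and $q_0\in\Omega\setminus\mathbb{R}$. Write $f=\Delta^m\tilde f$ with $m\ge0$ the largest integer for which this is possible with $\tilde f\in\mathcal{R}(\Omega)$, where $\Delta(q)=q^2-2q\,\mathrm{Re}(q_0)+|q_0|^2$ (so $\tilde f\not\equiv0$ on $\mathbb{S}_{q_0}$). The point $q_0$ is a non-real isolated zero of $f$ if $\tilde f(q_0)=0$. If $f^s\equiv0$, $f$ has no non-real isolated zeroes. *)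

(* Defs.v *)
From HB Require Import structures.
From mathcomp Require Import all_boot all_order all_algebra.
From mathcomp Require Import ring lra.
From mathcomp Require Import all_classical all_reals all_analysis.

Set Implicit Arguments.
Unset Strict Implicit.
Unset Printing Implicit Defensive.

Import Order.TTheory GRing.Theory Num.Theory.
Import numFieldNormedType.Exports.

Local Open Scope classical_set_scope.
Local Open Scope ring_scope.

(* [quat R] is R^4 with its topology and real vector space structure. Row vectors
of length 4 carry no ring structure in the library, so that [*%R] on [quat R]
is unambiguously the product of quaternions. Pitfall: the norm [`|q|] that
[quat R] inherits is the sup norm of the coordinates; it is only used through
the topology it induces. The Euclidean norm is [qnorm]. *)

Definition quat (R : realType) : Type := 'rV[R]_4.

HB.instance Definition _ (R : realType) :=
  NormedModule.copy (quat R) 'rV[R]_4.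

Definition Quat (R : realType) (a b c d : R) : quat R :=
  \row_(i < 4) [:: a; b; c; d]`_i.
Definition qre (R : realType) (q : quat R) : R := (q : 'rV[R]_4) 0 0.
Definition qi (R : realType) (q : quat R) : R := (q : 'rV[R]_4) 0 1.
Definition qj (R : realType) (q : quat R) : R := (q : 'rV[R]_4) 0 2.
Definition qk (R : realType) (q : quat R) : R := (q : 'rV[R]_4) 0 3.

Section QuaternionAlgebra.
Variable R : realType.
Implicit Types (p q r : quat R) (a : R).

Lemma quat_ext p q :
  qre p = qre q -> qi p = qi q -> qj p = qj q -> qk p = qk q -> p = q.
Proof.
move=> e0 e1 e2 e3; apply/rowP => -[[|[|[|[|//]]]] Hi].
- by rewrite (_ : Ordinal Hi = 0)//; exact: val_inj.
- by rewrite (_ : Ordinal Hi = 1)//; exact: val_inj.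
- by rewrite (_ : Ordinal Hi = 2)//; exact: val_inj.
- by rewrite (_ : Ordinal Hi = 3)//; exact: val_inj.
Qed.

Lemma qre_Quat (a b c d : R) : qre (Quat a b c d) = a.
Proof. by rewrite /qre mxE. Qed.
Lemma qi_Quat (a b c d : R) : qi (Quat a b c d) = b.
Proof. by rewrite /qi mxE. Qed.
Lemma qj_Quat (a b c d : R) : qj (Quat a b c d) = c.
Proof. by rewrite /qj mxE. Qed.
Lemma qk_Quat (a b c d : R) : qk (Quat a b c d) = d.
Proof. by rewrite /qk mxE. Qed.

Definition qmul p q : quat R :=
  Quat (qre p * qre q - qi p * qi q - qj p * qj q - qk p * qk q)
       (qre p * qi q + qi p * qre q + qj p * qk q - qk p * qj q)
       (qre p * qj q - qi p * qk q + qj p * qre q + qk p * qi q)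
       (qre p * qk q + qi p * qj q - qj p * qi q + qk p * qre q).

Definition qone : quat R := Quat 1 0 0 0.

Definition qconj q : quat R := Quat (qre q) (- qi q) (- qj q) (- qk q).

Definition qnorm q : R :=
  Num.sqrt (qre q ^+ 2 + qi q ^+ 2 + qj q ^+ 2 + qk q ^+ 2).

Definition qinv q : quat R := (qnorm q ^+ 2)^-1 *: qconj q.

Lemma qre0 : qre (0 : quat R) = 0.
Proof. by rewrite /qre mxE. Qed.
Lemma qreD p q : qre (p + q) = qre p + qre q.
Proof. by rewrite /qre mxE. Qed.
Lemma qreN p : qre (- p) = - qre p.
Proof. by rewrite /qre mxE. Qed.
Lemma qreZ a q : qre (a *: q) = a * qre q.
Proof. by rewrite /qre mxE. Qed.
Lemma qi0 : qi (0 : quat R) = 0.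
Proof. by rewrite /qi mxE. Qed.
Lemma qiD p q : qi (p + q) = qi p + qi q.
Proof. by rewrite /qi mxE. Qed.
Lemma qiN p : qi (- p) = - qi p.
Proof. by rewrite /qi mxE. Qed.
Lemma qiZ a q : qi (a *: q) = a * qi q.
Proof. by rewrite /qi mxE. Qed.
Lemma qj0 : qj (0 : quat R) = 0.
Proof. by rewrite /qj mxE. Qed.
Lemma qjD p q : qj (p + q) = qj p + qj q.
Proof. by rewrite /qj mxE. Qed.
Lemma qjN p : qj (- p) = - qj p.
Proof. by rewrite /qj mxE. Qed.
Lemma qjZ a q : qj (a *: q) = a * qj q.
Proof. by rewrite /qj mxE. Qed.
Lemma qk0 : qk (0 : quat R) = 0.
Proof. by rewrite /qk mxE. Qed.
Lemma qkD p q : qk (p + q) = qk p + qk q.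
Proof. by rewrite /qk mxE. Qed.
Lemma qkN p : qk (- p) = - qk p.
Proof. by rewrite /qk mxE. Qed.
Lemma qkZ a q : qk (a *: q) = a * qk q.
Proof. by rewrite /qk mxE. Qed.

Definition qlinE := (qre0, qi0, qj0, qk0, qreD, qiD, qjD, qkD, qreN, qiN, qjN, qkN, qreZ, qiZ, qjZ, qkZ,
  qre_Quat, qi_Quat, qj_Quat, qk_Quat).

Lemma qnorm2E q :
  qnorm q ^+ 2 = qre q ^+ 2 + qi q ^+ 2 + qj q ^+ 2 + qk q ^+ 2.
Proof. by rewrite sqr_sqrtr// !addr_ge0// sqr_ge0. Qed.

Lemma qnorm2_eq0 q : (qnorm q ^+ 2 == 0) = (q == 0).
Proof.
rewrite qnorm2E !paddr_eq0 ?addr_ge0 ?sqr_ge0// !sqrf_eq0.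
apply/idP/eqP => [/andP[/andP[/andP[/eqP ? /eqP ?] /eqP ?] /eqP ?]|->].
  by apply: quat_ext; rewrite !qlinE.
by rewrite !qlinE eqxx.
Qed.

Lemma qmulA : associative qmul.
Proof.
by move=> p q r; apply: quat_ext; rewrite /qmul /qone !qlinE; ring.
Qed.

Lemma qmul1l : left_id qone qmul.
Proof.
by move=> p; apply: quat_ext; rewrite /qmul /qone !qlinE; ring.
Qed.

Lemma qmul1r : right_id qone qmul.
Proof.
by move=> p; apply: quat_ext; rewrite /qmul /qone !qlinE; ring.
Qed.

Lemma qmulDl : left_distributive qmul +%R.
Proof.
by move=> p q r; apply: quat_ext; rewrite /qmul /qone !qlinE; ring.
Qed.

Lemma qmulDr : right_distributive qmul +%R.
Proof.
by move=> p q r; apply: quat_ext; rewrite /qmul /qone !qlinE; ring.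
Qed.

Lemma qone_neq0 : qone != 0.
Proof. by apply/eqP => /(congr1 (@qre R)) /eqP; rewrite !qlinE oner_eq0. Qed.

HB.instance Definition _ := GRing.Zmodule_isNzRing.Build (quat R)
  qmulA qmul1l qmul1r qmulDl qmulDr qone_neq0.

Lemma qre1 : qre (1 : quat R) = 1.
Proof. exact: qre_Quat. Qed.
Lemma qi1 : qi (1 : quat R) = 0.
Proof. exact: qi_Quat. Qed.
Lemma qj1 : qj (1 : quat R) = 0.
Proof. exact: qj_Quat. Qed.
Lemma qk1 : qk (1 : quat R) = 0.
Proof. exact: qk_Quat. Qed.
Lemma qreM p q :
  qre (p * q) = qre p * qre q - qi p * qi q - qj p * qj q - qk p * qk q.
Proof. exact: qre_Quat. Qed.
Lemma qiM p q :
  qi (p * q) = qre p * qi q + qi p * qre q + qj p * qk q - qk p * qj q.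
Proof. exact: qi_Quat. Qed.
Lemma qjM p q :
  qj (p * q) = qre p * qj q - qi p * qk q + qj p * qre q + qk p * qi q.
Proof. exact: qj_Quat. Qed.
Lemma qkM p q :
  qk (p * q) = qre p * qk q + qi p * qj q - qj p * qi q + qk p * qre q.
Proof. exact: qk_Quat. Qed.
Lemma qre_conj q : qre (qconj q) = qre q.
Proof. exact: qre_Quat. Qed.
Lemma qi_conj q : qi (qconj q) = - qi q.
Proof. exact: qi_Quat. Qed.
Lemma qj_conj q : qj (qconj q) = - qj q.
Proof. exact: qj_Quat. Qed.
Lemma qk_conj q : qk (qconj q) = - qk q.
Proof. exact: qk_Quat. Qed.

Definition qcoordE := (qlinE, (qre1, qi1, qj1, qk1, qreM, qiM, qjM, qkM,
  qre_conj, qi_conj, qj_conj, qk_conj)).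

Lemma qscalerAl a p q : a *: (p * q) = a *: p * q.
Proof. by apply: quat_ext; rewrite !qcoordE; ring. Qed.

HB.instance Definition _ :=
  GRing.Lmodule_isLalgebra.Build R (quat R) qscalerAl.

Lemma qscalerAr a p q : a *: (p * q) = p * (a *: q).
Proof. by apply: quat_ext; rewrite !qcoordE; ring. Qed.

HB.instance Definition _ :=
  GRing.Lalgebra_isAlgebra.Build R (quat R) qscalerAr.

Lemma qmulVq : {in [pred q : quat R | q != 0], left_inverse 1 qinv *%R}.
Proof.
move=> q; rewrite inE -qnorm2_eq0 => q0.
rewrite /qinv -scalerAl; apply: (can_inj (scalerK q0)).
rewrite scalerA divff// scale1r.
by apply: quat_ext; rewrite !qcoordE qnorm2E; ring.
Qed.

Lemma qmulqV : {in [pred q : quat R | q != 0], right_inverse 1 qinv *%R}.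
Proof.
move=> q; rewrite inE -qnorm2_eq0 => q0.
rewrite /qinv -scalerAr; apply: (can_inj (scalerK q0)).
rewrite scalerA divff// scale1r.
by apply: quat_ext; rewrite !qcoordE qnorm2E; ring.
Qed.

Lemma qunitP p q : q * p = 1 /\ p * q = 1 -> p \in [pred q : quat R | q != 0].
Proof.
move=> [_ pq]; rewrite inE; apply/eqP => p0.
by move: pq; rewrite p0 mul0r => /esym/eqP; rewrite oner_eq0.
Qed.

Lemma qinv_out : {in [predC [pred q : quat R | q != 0]], qinv =1 id}.
Proof.
move=> q; rewrite !inE negbK => /eqP ->.
by apply: quat_ext; rewrite /qinv /qconj !qlinE ?oppr0 mulr0.
Qed.

HB.instance Definition _ := GRing.NzRing_hasMulInverse.Build (quat R)
  qmulVq qmulqV qunitP qinv_out.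

End QuaternionAlgebra.

Section SliceRegular.
Variable R : realType.
Notation H := (quat R).
Implicit Types (Omega : set H) (f g : H -> H) (q I : H).

Definition ei : H := Quat 0 1 0 0.
Definition ej : H := Quat 0 0 1 0.
Definition ek : H := Quat 0 0 0 1.

Definition qvec q : H := q - (qre q)%:A.

Definition real_axis : set H := [set a%:A | a in [set: R]].

Definition imag_units : set H := [set I | I ^+ 2 = -1].

Definition slice_plane I : set H := [set q | exists a b : R, q = a%:A + b *: I].

Definition qsphere q : set H :=
  [set (qre q)%:A + qnorm (qvec q) *: J | J in imag_units].

Definition slice Omega I : set H := Omega `&` slice_plane I.

Definition domain (T : topologicalType) (A : set T) : Prop :=
  [/\ A !=set0, open A & connected A].

(* domain of the subspace [X] of [T] *)
Definition domain_in (T : topologicalType) (X A : set T) : Prop :=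
  [/\ A !=set0, A `<=` X, open (A : set (subspace X)) & connected A].

Definition simply_connected (T : topologicalType) (A : set T) : Prop :=
  forall gamma : R -> T,
    {within `[0, 1], continuous gamma} ->
    gamma @` `[0, 1] `<=` A ->
    gamma 0 = gamma 1 ->
    exists h : R * R -> T,
      [/\ {within `[0, 1] `*` `[0, 1], continuous h},
          h @` (`[0, 1] `*` `[0, 1]) `<=` A,
          forall t, t \in `[0, 1] -> h (0, t) = gamma t,
          forall t, t \in `[0, 1] -> h (1, t) = gamma 0
        & forall s, s \in `[0, 1] -> h (s, 0) = gamma 0 /\ h (s, 1) = gamma 0].

Definition circular Omega : Prop := forall q, Omega q -> qsphere q `<=` Omega.

Definition slice_domain Omega : Prop :=
  domain Omega /\ Omega `&` real_axis !=set0.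

Definition slice_contractible Omega : Prop :=
  exists2 I, imag_units I &
    domain_in (slice_plane I) (slice Omega I) /\
    simply_connected (slice Omega I).

(* Functions on [Omega] are total functions on the quaternions, of which only the
values on [Omega] are relevant. The point [z : R * R] stands for the complex
number [z.1 + sqrt(-1) z.2]. *)

Definition stem_domain Omega : set (R * R) :=
  [set z | exists2 I, imag_units I & Omega (z.1%:A + I * z.2%:A)].

Definition C1_on (D : set (R * R)) (F : R * R -> H) : Prop :=
  forall z, D z ->
    [/\ derivable F z (1, 0), derivable F z (0, 1),
        {for z, continuous (fun w => 'D_(1, 0) F w)}
      & {for z, continuous (fun w => 'D_(0, 1) F w)}].

Definition regular_stem Omega (F0 F1 : R * R -> H) : Prop :=
  [/\ C1_on (stem_domain Omega) F0,
      C1_on (stem_domain Omega) F1,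
      forall z, stem_domain Omega z ->
        F0 (z.1, - z.2) = F0 z /\ F1 (z.1, - z.2) = - F1 z
    & forall z, stem_domain Omega z ->
        'D_(1, 0) F0 z = 'D_(0, 1) F1 z /\
        'D_(0, 1) F0 z = - 'D_(1, 0) F1 z].

Definition induced Omega (F0 F1 : R * R -> H) f : Prop :=
  forall (I : H) (a b : R), imag_units I -> Omega (a%:A + I * b%:A) ->
    f (a%:A + I * b%:A) = F0 (a, b) + I * F1 (a, b).

Definition slice_regular Omega f : Prop :=
  exists F0 F1, regular_stem Omega F0 F1 /\ induced Omega F0 F1 f.

Definition slice_preserving Omega f : Prop :=
  slice_regular Omega f /\
  forall I, imag_units I -> f @` slice Omega I `<=` slice_plane I.

Definition star f g : H -> H :=
  fun q => if f q == 0 then 0 else f q * g ((f q)^-1 * q * f q).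

Fixpoint starX f (n : nat) : H -> H :=
  if n is m.+1 then star f (starX f m) else cst 1.

Definition exp_star f : H -> H :=
  fun q => limn (series (fun n => (n`!%:R : R)^-1 *: starX f n q)).

Definition star_logarithm Omega g f : Prop :=
  slice_regular Omega f /\ forall q, Omega q -> exp_star f q = g q.

(* The slice conjugate and the vector part are functions on [Omega], hence
   unique only up to their values outside [Omega]: they are given as relations. *)
Definition is_slice_conj Omega f fc : Prop :=
  exists F0 F1, [/\ regular_stem Omega F0 F1, induced Omega F0 F1 f
    & induced Omega (@qconj R \o F0) (@qconj R \o F1) fc].

Definition is_vector_part Omega f fv : Prop :=
  exists f0 f1 f2 f3,
    [/\ [/\ slice_preserving Omega f0, slice_preserving Omega f1,
            slice_preserving Omega f2 & slice_preserving Omega f3],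
        forall q, Omega q ->
          f q = f0 q + f1 q * ei + f2 q * ej + f3 q * ek
      & forall q, Omega q -> fv q = f q - f0 q].

Definition Delta q0 : H -> H :=
  fun q => q ^+ 2 - (2 * qre q0) *: q + (qnorm q0 ^+ 2)%:A.

(* [Delta q0] is slice preserving, so its powers and products with other
   functions may be taken pointwise. *)
Definition Delta_factor Omega q0 f (m : nat) ft : Prop :=
  slice_regular Omega ft /\
  forall q, Omega q -> f q = Delta q0 q ^+ m * ft q.

Definition nonreal_isolated_zero Omega f q0 : Prop :=
  [/\ slice_regular Omega f,
      (exists2 fc, is_slice_conj Omega f fc &
        exists2 q, Omega q & star f fc q != 0),
      (Omega `\` real_axis) q0
    & exists m ft,
        [/\ Delta_factor Omega q0 f m ft,
            forall n gt, Delta_factor Omega q0 f n gt -> (n <= m)%N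
          & ft q0 = 0]].

End SliceRegular.

(* Main.v *)
Require Import Defs.
From HB Require Import structures.
From mathcomp Require Import all_boot all_order all_algebra.
From mathcomp Require Import ring lra.
From mathcomp Require Import complex.
From mathcomp Require Import all_classical all_reals all_analysis.

Set Implicit Arguments.
Unset Strict Implicit.
Unset Printing Implicit Defensive.

Import Order.TTheory GRing.Theory Num.Theory.
Import numFieldNormedType.Exports.
Import Normc.

Local Open Scope classical_set_scope.
Local Open Scope ring_scope.

Local Notation re := (@complex.Re _).
Local Notation im := (@complex.Im _).

(** A regular function on a circular slice domain is determined by its stem: a
holomorphic map from a symmetric plane domain to the complexified quaternions,
that is, four holomorphic coordinates compatible with conjugation. On stems the
star product is the pointwise product, so the star exponential is the pointwise
exponential of the complexified quaternions ([exp_star_stem_eval]). For a scalar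
[x] and a vector [V] one has [exp (x + V) = A + B V] with complex numbers [A] and
[B]; its norm [A^2 + N(V) B^2] is the square of [e^x], and [A = e^x] when the norm
[N(V)], the sum of the squares of the coordinates of [V], is zero.

Suppose that [f] and [h] are star logarithms of [g] and [- g]. Their scalar parts
[f0] and [h0] satisfy [(e^f0)^2 = (e^h0)^2], both sides being the norm of the stem
of [g]. Hence [e^(h0 - f0)] takes the values 1 and -1 only, and is constant on
the connected stem domain; it is positive at a real point, where stems are real,
so it is 1.

The non-real isolated zero contradicts this. Write the vector part of [g] as
[Delta^m t], with [m] maximal. The stem of [t] is nonzero at the corresponding
point [z0], for otherwise one more factor [Delta] could be extracted; but its
value on one slice is zero, so it is a null vector: the sum of the squares of its
coordinates is zero ([stem_eval_eq0_norm]). The vector part of [f] is parallel to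
[t] away from [z0], hence at [z0] by continuity, so it is null there as well, and
[g0 = e^f0] at [z0] ([star_log_at_zero]). For the same reason [- g0 = e^h0] at
[z0], so [e^(h0 - f0)] is -1 at [z0].

The extraction of a factor [Delta] is the only analytic step
([Delta_factor_succ]): a holomorphic function of class C^1 vanishing at [c] is
divisible by [z - c] with a quotient of class C^1 ([holo_div_zero]). It is obtained
from Cauchy's formula on a circle, proved by contracting the circle to a point
and differentiating under the integral sign ([cauchy_re]). *)

(** * Functions of two real variables with continuous partial derivatives *)

Section PlaneCalculus.
Variable R : realType.
Implicit Types (u p q : R * R -> R) (z w : R * R).

(** A mean value theorem for increments [h] of either sign, as they occur along
the two axes. *)
Lemma MVT_ball (f df : R -> R) (x h : R) :
  (forall y, `|y - x| <= `|h| -> is_derive y 1 f (df y)) ->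
  exists2 c, `|c - x| <= `|h| & f (x + h) - f x = df c * h.
Proof.
move=> fdf.
have ccontT (a b : R) : (forall y, y \in `[a, b] -> `|y - x| <= `|h|) ->
    {within `[a, b], continuous f}.
  move=> ab; apply: derivable_within_continuous => y /ab /fdf.
  by move=> ?; exact: ex_derive.
have [h0|h0] := leP 0 h.
  have sub y : y \in `[x, x + h] -> `|y - x| <= `|h|.
    by rewrite in_itv/= => /andP[? ?]; rewrite !ger0_norm//; lra.
  have [|||c cI ->] := @MVT_segment _ f df x (x + h).
  - lra.
  - by move=> y /subset_itv_oo_cc; rewrite inE => /sub/fdf.
  - exact: ccontT.
  by exists c; [exact: sub|congr (_ * _); lra].
have sub y : y \in `[x + h, x] -> `|y - x| <= `|h|.
  rewrite in_itv/= => /andP[? ?]; rewrite (ltr0_norm h0) ler0_norm; lra.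
have [|||c cI e] := @MVT_segment _ f df (x + h) x.
- lra.
- by move=> y /subset_itv_oo_cc; rewrite inE => /sub/fdf.
- exact: ccontT.
exists c; first exact: sub.
by rewrite -opprB e; lra.
Qed.

Lemma is_derive_fst u (a b d : R) : is_derive (a, b) (1, 0) u d <->
  is_derive a 1 (fun s => u (s, b)) d.
Proof.
have E : (fun h => h^-1 *: ((u \o shift (a, b)) (h *: (1, 0)) - u (a, b))) =
  (fun h => h^-1 *: (((fun s => u (s, b)) \o shift a) (h *: 1) - u (a, b))).
  apply/funext => h /=; congr (_ *: (u _ - _)).
  by apply/pair_equal_spec; split => //=; rewrite scaler0 add0r.
split=> -[d1 d2].
  by apply: DeriveDef; [rewrite /derivable -E|rewrite /derive -E].
by apply: DeriveDef; [rewrite /derivable E|rewrite /derive E].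
Qed.

Lemma is_derive_snd u (a b d : R) : is_derive (a, b) (0, 1) u d <->
  is_derive b 1 (fun s => u (a, s)) d.
Proof.
have E : (fun h => h^-1 *: ((u \o shift (a, b)) (h *: (0, 1)) - u (a, b))) =
  (fun h => h^-1 *: (((fun s => u (a, s)) \o shift b) (h *: 1) - u (a, b))).
  apply/funext => h /=; congr (_ *: (u _ - _)).
  by apply/pair_equal_spec; split => //=; rewrite scaler0 add0r.
split=> -[d1 d2].
  by apply: DeriveDef; [rewrite /derivable -E|rewrite /derive -E].
by apply: DeriveDef; [rewrite /derivable E|rewrite /derive E].
Qed.

Lemma ball_pairE z w (e : R) :
  ball z e w <-> `|z.1 - w.1| < e /\ `|z.2 - w.2| < e.
Proof. by []. Qed.

Definition lin2 (a b : R) (h : R * R) : R^o := h.1 * a + h.2 * b.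

Fact lin2_is_linear a b : linear (lin2 a b).
Proof. by move=> k [x y] [x' y'] /=; rewrite /lin2/= /GRing.scale/=; ring. Qed.

HB.instance Definition _ a b :=
  GRing.isLinear.Build R (R * R)%type R^o _ (lin2 a b) (lin2_is_linear a b).

Definition has_grad u z (a b : R) : Prop :=
  is_derive (z : R * R) (1, 0) u a /\ is_derive (z : R * R) (0, 1) u b.

(** Moving first along one axis and then along the other, each step is controlled
by the mean value theorem, and the two intermediate gradients are close to the
one at [z] by continuity. *)
Lemma C1_is_diff u p q z :
  (\forall w \near z, has_grad u w (p w) (q w)) ->
  {for z, continuous p} -> {for z, continuous q} ->
  is_diff z u (fun h : R * R => h.1 * p z + h.2 * q z).
Proof.
move=> duz pz qz.
pose Lf : {linear (R * R)%type -> R^o} := lin2 (p z) (q z).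
have Lc : continuous Lf.
  move=> w; apply: (@cvgD _ _ _ _ _ (fun h : R * R => h.1 * p z) (fun h : R * R => h.2 * q z)).
    by apply: cvgM; [exact: cvg_fst|exact: cvg_cst].
  by apply: cvgM; [exact: cvg_snd|exact: cvg_cst].
pose v : (R * R)%type -> R^o := u.
(* [R^o] is the normed module over [R] on which the Landau notation is stated. *)
have uL : v \o shift z = cst (v z) + Lf +o_ (0 : R * R) id.
  apply/eqaddoP => eps eps0.
  have /nbhs_ballP[d /= d0 zd] : \forall w \near z,
      [/\ has_grad u w (p w) (q w),
       `|p z - p w| <= eps / 2 & `|q z - q w| <= eps / 2].
    have e2 : 0 < eps / 2 by rewrite divr_gt0.
    near=> w; split; [by near: w|near: w|near: w].
    - by move/cvgrPdist_le : pz; exact.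
    - by move/cvgrPdist_le : qz; exact.
  near=> h; rewrite !fctE /=.
  (* The two legs of the path from [z] to [z + h] stay in the ball. *)
  have [h1d h2d] : `|h.1| < d /\ `|h.2| < d.
    have [] : ball (0 : R * R) d h by near: h; exact: nbhsx_ballx.
    by rewrite /ball/= !sub0r !normrN.
  have [h1h h2h] : `|h.1| <= `|h| /\ `|h.2| <= `|h|.
    by rewrite [`|h|]/Num.norm/= !le_max !lexx orbT.
  have [c1 c1h e1] : exists2 c, `|c - z.1| <= `|h.1| &
      u (z.1 + h.1, z.2 + h.2) - u (z.1, z.2 + h.2) = p (c, z.2 + h.2) * h.1.
    apply: (@MVT_ball (fun s => u (s, z.2 + h.2)) (fun s => p (s, z.2 + h.2))).
    move=> y yh; apply/is_derive_fst; suff /zd[[]] : ball z d (y, z.2 + h.2) by [].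
    by apply/ball_pairE; split => /=; [rewrite distrC; lra|rewrite opprD addNKr normrN; lra].
  have [c2 c2h e2] : exists2 c, `|c - z.2| <= `|h.2| &
      u (z.1, z.2 + h.2) - u (z.1, z.2) = q (z.1, c) * h.2.
    apply: (@MVT_ball (fun s => u (z.1, s)) (fun s => q (z.1, s))).
    move=> y yh; apply/is_derive_snd; suff /zd[[]] : ball z d (z.1, y) by [].
    by apply/ball_pairE; split => /=; [rewrite subrr normr0|rewrite distrC; lra].
  rewrite /v /lin2 /=.
  have -> : h + z = (z.1 + h.1, z.2 + h.2) by rewrite addrC.
  have [_ pc _] : [/\ has_grad u (c1, z.2 + h.2) (p (c1, z.2 + h.2))
      (q (c1, z.2 + h.2)), `|p z - p (c1, z.2 + h.2)| <= eps / 2 &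
      `|q z - q (c1, z.2 + h.2)| <= eps / 2].
    by apply: zd; apply/ball_pairE; split => /=; [rewrite distrC; lra|rewrite opprD addNKr normrN; lra].
  have [_ _ qc] : [/\ has_grad u (z.1, c2) (p (z.1, c2)) (q (z.1, c2)),
      `|p z - p (z.1, c2)| <= eps / 2 & `|q z - q (z.1, c2)| <= eps / 2].
    by apply: zd; apply/ball_pairE; split => /=; [rewrite subrr normr0|rewrite distrC; lra].
  have -> : u (z.1 + h.1, z.2 + h.2) - (u z + (h.1 * p z + h.2 * q z)) =
      - ((p z - p (c1, z.2 + h.2)) * h.1 + (q z - q (z.1, c2)) * h.2).
    have -> : u z = u (z.1, z.2) by case: (z).
    by move: e1 e2; lra.
  rewrite normrN (le_trans (ler_normD _ _))// !normrM.
  rewrite (_ : eps * `|h| = eps / 2 * `|h| + eps / 2 * `|h|); last by field.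
  by rewrite lerD// ler_pM.
have dL := diff_unique Lc uL.
split; last by rewrite dL.
apply/diff_locallyP; rewrite dL; split => //; exact: Lc.
Unshelve. all: by end_near. Qed.

End PlaneCalculus.

(** * Complex-valued functions and integrals over a period *)

Section Cauchy.
Variable R : realType.
Local Notation C := (R[i]).
Implicit Types (z w : R * R).

Lemma derive_curve (u p q : R * R -> R) (c1 c2 : R -> R) (t d1 d2 : R) :
  (\forall w \near (c1 t, c2 t), has_grad u w (p w) (q w)) ->
  {for (c1 t, c2 t), continuous p} -> {for (c1 t, c2 t), continuous q} ->
  is_derive t 1 c1 d1 -> is_derive t 1 c2 d2 ->
  is_derive t 1 (fun s => u (c1 s, c2 s))
    (p (c1 t, c2 t) * d1 + q (c1 t, c2 t) * d2).
Proof.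
move=> du cp cq dc1 dc2.
have [dfu valu] := C1_is_diff du cp cq.
have /derivable1_diffP dfc1 : derivable c1 t 1 by exact: ex_derive.
have /derivable1_diffP dfc2 : derivable c2 t 1 by exact: ex_derive.
have dfc : differentiable (fun s => (c1 s, c2 s)) t by exact: differentiable_pair.
have duc : differentiable (u \o (fun s => (c1 s, c2 s))) t.
  exact: differentiable_comp.
apply: DeriveDef; first exact/derivable1_diffP.
rewrite [LHS](deriveE _ duc) diff_comp// /= valu diff_pair//=.
rewrite -!deriveE// !derive_val.
by rewrite ![_ * d1]mulrC ![_ * d2]mulrC.
Qed.

(** The Cauchy-Riemann equations, with the complex derivative [f' z] as data:
the gradients of the real and imaginary parts are read off from it. *)
Definition has_cderiv (f f' : R * R -> C) z : Prop :=
  has_grad (fun w => re (f w)) z (re (f' z)) (- im (f' z)) /\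
  has_grad (fun w => im (f w)) z (im (f' z)) (re (f' z)).

(** Continuity of a complex-valued function, tested on real and imaginary parts
so that only the topology of the reals is involved. *)
Definition ccont (T : topologicalType) (f : T -> C) (t : T) : Prop :=
  {for t, continuous (fun s => re (f s))} /\ {for t, continuous (fun s => im (f s))}.

(** Holomorphic of class C^1 in a neighbourhood of [z]; the derivative is required
to be continuous nearby because the proof of Cauchy's formula integrates it. *)
Definition holo_at (f : R * R -> C) z : Prop :=
  exists f', \forall w \near z, has_cderiv f f' w /\ ccont f' w.

Local Notation mu := (@lebesgue_measure R).
Definition circle_int (g : R -> R) : R := \int[mu]_(x in `[0, 2 * pi]) g x.

Lemma circle_int_integrable (g : R -> R) : continuous g ->
  mu.-integrable `[0, 2 * pi] (EFin \o g).
Proof.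
move=> cg; apply: continuous_compact_integrable; first exact: segment_compact.
exact: continuous_subspaceT.
Qed.

(** The integrals that vanish in Cauchy's theorem do so because they are of this
form with [g] of period [2 * pi]. *)
Lemma circle_int_derive (g g' : R -> R) : continuous g' ->
  (forall x : R, is_derive x 1 g (g' x)) -> circle_int g' = g (2 * pi) - g 0.
Proof.
move=> cg dg; rewrite /circle_int /Rintegral (@continuous_FTC2 _ _ g)//.
- by rewrite mulr_gt0// pi_gt0.
- exact: continuous_subspaceT.
- have cgg : continuous g.
    by move=> x; apply/differentiable_continuous/derivable1_diffP; exact: ex_derive.
  split; first by move=> x _; exact: ex_derive.
    by apply: cvg_at_right_filter; exact: cgg.
  by apply: cvg_at_left_filter; exact: cgg.
- by move=> x _; rewrite derive1E derive_val.
Qed.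

Section ccont_theory.
Variable T : topologicalType.
Implicit Types (f g : T -> C) (t : T).

Lemma ccont_cst (k : C) t : ccont (fun=> k) t.
Proof. by split; exact: cvg_cst. Qed.

Lemma ccontD f g t : ccont f t -> ccont g t -> ccont (fun s => f s + g s) t.
Proof.
move=> [f0 f1] [g0 g1]; split.
  by under [X in {for _, continuous X}]eq_fun do rewrite raddfD/=; exact: cvgD.
by under [X in {for _, continuous X}]eq_fun do rewrite raddfD/=; exact: cvgD.
Qed.

Lemma reM (x y : C) : re (x * y) = re x * re y - im x * im y.
Proof. by case: x y => [? ?] [? ?]. Qed.
Lemma imM (x y : C) : im (x * y) = re x * im y + im x * re y.
Proof. by case: x y => [? ?] [? ?]. Qed.
Lemma reD (x y : C) : re (x + y) = re x + re y.
Proof. by case: x y => [? ?] [? ?]. Qed.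
Lemma imD (x y : C) : im (x + y) = im x + im y.
Proof. by case: x y => [? ?] [? ?]. Qed.
Lemma reN (x : C) : re (- x) = - re x.
Proof. by case: x. Qed.
Lemma imN (x : C) : im (- x) = - im x.
Proof. by case: x. Qed.
Lemma reV (x : C) : re (x^-1) = re x / (re x ^+ 2 + im x ^+ 2).
Proof. by case: x. Qed.
Lemma imV (x : C) : im (x^-1) = - (im x / (re x ^+ 2 + im x ^+ 2)).
Proof. by case: x. Qed.
Lemma complex_eq (x y : C) : re x = re y -> im x = im y -> x = y.
Proof. by case: x y => [? ?] [? ?] /= -> ->. Qed.
Lemma sqr_re_im_neq0 (x : C) : x != 0 -> re x ^+ 2 + im x ^+ 2 != 0.
Proof.
apply: contra; rewrite paddr_eq0 ?sqr_ge0// !sqrf_eq0 => /andP[/eqP x0 /eqP x1].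
by apply/eqP/complex_eq.
Qed.

Lemma ccontM f g t : ccont f t -> ccont g t -> ccont (fun s => f s * g s) t.
Proof.
move=> [f0 f1] [g0 g1]; split.
  by under [X in {for _, continuous X}]eq_fun do rewrite reM; apply: cvgB; apply: cvgM.
by under [X in {for _, continuous X}]eq_fun do rewrite imM; apply: cvgD; apply: cvgM.
Qed.

Lemma ccontN f t : ccont f t -> ccont (fun s => - f s) t.
Proof.
move=> [f0 f1]; split.
  by under [X in {for _, continuous X}]eq_fun do rewrite reN; apply: cvgN.
by under [X in {for _, continuous X}]eq_fun do rewrite imN; apply: cvgN.
Qed.

Lemma ccontV f t : ccont f t -> f t != 0 -> ccont (fun s => (f s)^-1) t.
Proof.
move=> [f0 f1] /sqr_re_im_neq0 ft0.
have n0 : (fun s => (re (f s) ^+ 2 + im (f s) ^+ 2)^-1) @ t -->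
    (re (f t) ^+ 2 + im (f t) ^+ 2)^-1.
  by apply: cvgV => //; apply: cvgD; rewrite !expr2; apply: cvgM.
split.
  by under [X in {for _, continuous X}]eq_fun do rewrite reV; apply: cvgM.
by under [X in {for _, continuous X}]eq_fun do rewrite imV; apply: cvgN; apply: cvgM.
Qed.

End ccont_theory.

End Cauchy.

(** * Cauchy's formula on a circle *)

Section CauchyCore.
Variable R : realType.
Local Notation C := (R[i]).
Implicit Types (z w : R * R).

(** Along a curve with velocity [d] the complex derivative multiplies [d]. *)
Lemma derive_curve_cr (f f' : R * R -> C) (c1 c2 : R -> R) (t : R) (d : C) :
  (\forall w \near (c1 t, c2 t), has_cderiv f f' w) -> ccont f' (c1 t, c2 t) ->
  is_derive t 1 c1 (re d) -> is_derive t 1 c2 (im d) ->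
  is_derive t 1 (fun s => re (f (c1 s, c2 s))) (re (f' (c1 t, c2 t) * d)) /\
  is_derive t 1 (fun s => im (f (c1 s, c2 s))) (im (f' (c1 t, c2 t) * d)).
Proof.
move=> cr [cf0 cf1] d1 d2; rewrite reM imM; split.
  rewrite -mulNr; apply: (@derive_curve _ (fun w => re (f w))
    (fun w => re (f' w)) (fun w => - im (f' w))) => //.
    by near=> w; have [] : has_cderiv f f' w by near: w.
  exact: cvgN.
rewrite addrC; apply: (@derive_curve _ (fun w => im (f w))
  (fun w => im (f' w)) (fun w => re (f' w))) => //.
by near=> w; have [] : has_cderiv f f' w by near: w.
Unshelve. all: by end_near. Qed.

Definition circle_vec (r x : R) : C := Complex (r * cos x) (r * sin x).

Lemma is_derive_mulr_cst (g : R -> R) (x d k : R) :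
  is_derive x 1 g d -> is_derive x 1 (fun y => g y * k) (d * k).
Proof.
move=> dg; have := @is_deriveZ _ _ _ g k x 1 _ dg.
by rewrite /GRing.scale/= mulrC; congr is_derive; apply/funext => y; rewrite /= mulrC.
Qed.

Lemma is_derive_affine (a k t : R) : is_derive t 1 (fun s => a + s * k) k.
Proof.
have := is_deriveD (is_derive_cst a t 1) (is_derive_mulr_cst k (is_derive_id t 1)).
by rewrite add0r mul1r.
Qed.

Lemma is_derive_circle_vec r (x : R) :
  is_derive x 1 (fun y => re (circle_vec r y)) (re (circle_vec r x * Complex 0 1)) /\
  is_derive x 1 (fun y => im (circle_vec r y)) (im (circle_vec r x * Complex 0 1)).
Proof.
rewrite /circle_vec /= !mulr0 !mulr1 sub0r addr0; split.
  have := is_derive_mulr_cst r (is_derive_cos x).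
  by rewrite mulNr mulrC; congr is_derive; apply/funext => y; rewrite mulrC.
have := is_derive_mulr_cst r (is_derive_sin x).
by rewrite mulrC; congr is_derive; apply/funext => y; rewrite mulrC.
Qed.

Lemma ccont_derivable (f : R -> C) (x a b : R) :
  is_derive x 1 (fun y => re (f y)) a -> is_derive x 1 (fun y => im (f y)) b ->
  ccont f x.
Proof.
move=> da db; split; apply/differentiable_continuous/derivable1_diffP;
exact: ex_derive.
Qed.

Section circle.
Variables (f f' : R * R -> C) (c z : R * R) (r M : R).
Hypothesis r0 : 0 < r.
Hypothesis fB : forall w, ball c (4 * r) w -> has_cderiv f f' w /\ ccont f' w.
Hypothesis fM : forall w, ball c (4 * r) w -> `|re (f' w)| <= M /\ `|im (f' w)| <= M.
Hypothesis zr : ball c (r / 2) z.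

Let dz : C := Complex (z.1 - c.1) (z.2 - c.2).
Let K x : C := circle_vec r x / (circle_vec r x - dz).
Let g1 t x : R := z.1 + t * (c.1 + r * cos x - z.1).
Let g2 t x : R := z.2 + t * (c.2 + r * sin x - z.2).

Lemma circle_den_neq0 x : circle_vec r x - dz != 0.
Proof.
apply/eqP => /subr0_eq[e1 e2]; have := cos2Dsin2 x => e3.
have /ball_pairE[/= z1 z2] := zr; rewrite distrC -e1 in z1; rewrite distrC -e2 in z2.
have q1 : (r * cos x) ^+ 2 < (r / 2) ^+ 2 by rewrite -real_normK ?num_real// ltr_sqr ?nnegrE ?normr_ge0 ?divr_ge0 ?(ltW r0)//.
have q2 : (r * sin x) ^+ 2 < (r / 2) ^+ 2 by rewrite -real_normK ?num_real// ltr_sqr ?nnegrE ?normr_ge0 ?divr_ge0 ?(ltW r0)//.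
have r2 : 0 < r ^+ 2 by rewrite exprn_gt0.
have : r ^+ 2 * (cos x ^+ 2 + sin x ^+ 2) < r ^+ 2 by nra.
by rewrite e3 mulr1 ltxx.
Qed.

(** The range [-1 < t < 2] is an open interval around [0, 1], so that the integral
over the contracted circle can be differentiated at both ends; the factor 4
leaves room for the circles outside of the segment. *)
Lemma segment_in_ball (t x : R) : -1 < t < 2 -> ball c (4 * r) (g1 t x, g2 t x).
Proof.
move=> t12; have /ball_pairE[/= z1 z2] := zr.
have box (a b : R) : `|a| < r / 2 -> `|b| <= 1 -> `|(1 - t) * a - t * (r * b)| < 4 * r.
  move=> ar b1; rewrite (le_lt_trans (ler_normB _ _))// !normrM (gtr0_norm r0).
  have t1 : `|1 - t| <= 2 by rewrite ler_norml; lra.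
  have t2 : `|t| <= 2 by rewrite ler_norml; lra.
  have : `|1 - t| * `|a| <= 2 * (r / 2) by rewrite ler_pM// ltW.
  have : `|t| * (r * `|b|) <= 2 * (r * 1) by rewrite ler_pM// ?mulr_ge0 ?ler_pM2l// ltW.
  move=> i1 i2; rewrite (le_lt_trans (lerD i2 i1))//. have r1 := r0; lra.
apply/ball_pairE; split; rewrite /= /g1 /g2.
  have := box _ _ z1 (cos_max x); congr (`|_| < _); ring.
have := box _ _ z2 (sin_max x); congr (`|_| < _); ring.
Qed.

Lemma near_cr_ball w : ball c (4 * r) w -> \forall w' \near w, has_cderiv f f' w'.
Proof.
move=> cw; have : \forall w' \near w, ball c (4 * r) w'.
  have r1 := r0; apply: open_nbhs_nbhs; split => //; apply: ball_open; lra.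
by apply: filterS => w' /fB[].
Qed.

Lemma ccont_kernel x : ccont K x.
Proof.
have [d1 d2] := is_derive_circle_vec r x; have ce := ccont_derivable d1 d2.
apply: ccontM => //; apply: ccontV; last exact: circle_den_neq0.
by apply: ccontD => //; exact: ccont_cst.
Qed.

(** The factor [circle_vec r x - dz] produced by the chain rule cancels the
denominator of the kernel [K]. *)
Lemma derive_radial (t x : R) : -1 < t < 2 ->
  is_derive t 1 (fun s => re (f (g1 s x, g2 s x) * K x))
    (re (f' (g1 t x, g2 t x) * circle_vec r x)).
Proof.
move=> /(segment_in_ball x) gB.
have [] := @derive_curve_cr f f' (g1 ^~ x) (g2 ^~ x) t (circle_vec r x - dz).
- exact: near_cr_ball.
- by have [] := fB gB.
- have -> : re (circle_vec r x - dz) = c.1 + r * cos x - z.1 by rewrite reD reN /=; ring.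
  exact: is_derive_affine.
- have -> : im (circle_vec r x - dz) = c.2 + r * sin x - z.2 by rewrite imD imN /=; ring.
  exact: is_derive_affine.
move=> d1 d2.
have := is_deriveB (is_derive_mulr_cst (re (K x)) d1) (is_derive_mulr_cst (im (K x)) d2).
congr is_derive; first by apply/funext => s; rewrite !fctE reM.
by rewrite -reM; congr re; rewrite /K -mulrA [_ * (_ / _)]mulrC divfK// circle_den_neq0.
Qed.

(** Up to the factor [t], the angular derivative of the imaginary part is the
radial derivative of the integrand of Cauchy's formula. This coincidence makes
the integral over the contracted circle stationary. *)
Lemma derive_angular (t x : R) : -1 < t < 2 ->
  is_derive x 1 (fun y => re (f (g1 t y, g2 t y)))
    (- t * im (f' (g1 t x, g2 t x) * circle_vec r x)) /\
  is_derive x 1 (fun y => im (f (g1 t y, g2 t y)))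
    (t * re (f' (g1 t x, g2 t x) * circle_vec r x)).
Proof.
move=> /(segment_in_ball x) gB.
have [d1 d2] := is_derive_circle_vec r x.
have [] := @derive_curve_cr f f' (g1 t) (g2 t) x (Complex t 0 * (circle_vec r x * Complex 0 1)).
- exact: near_cr_ball.
- by have [] := fB gB.
- have := is_deriveD (is_derive_cst (z.1 + t * (c.1 - z.1)) x 1) (is_derive_mulr_cst t d1).
  congr is_derive; last by rewrite !(reM, imM) /=; ring.
  by apply/funext => y; rewrite !fctE /g1 /=; ring.
- have := is_deriveD (is_derive_cst (z.2 + t * (c.2 - z.2)) x 1) (is_derive_mulr_cst t d2).
  congr is_derive; last by rewrite !(reM, imM) /=; ring.
  by apply/funext => y; rewrite !fctE /g2 /=; ring.
by split; [move: a|move: b]; congr is_derive; rewrite !(reM, imM) /=; ring.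
Qed.

Lemma ccont_angular (t x : R) : -1 < t < 2 ->
  ccont (fun y => f (g1 t y, g2 t y)) x /\ ccont (fun y => f' (g1 t y, g2 t y)) x.
Proof.
move=> t12; have [d1 d2] := derive_angular x t12; split.
  exact: ccont_derivable d1 d2.
have gc : {for x, continuous (fun y => (g1 t y, g2 t y))}.
  have [/ccont_derivable e /e[c1 c2]] := is_derive_circle_vec r x.
  have E : (fun y => (g1 t y, g2 t y)) @ x --> (nbhs (g1 t x), nbhs (g2 t x)); last exact: E.
  apply: cvg_pair => /=.
    apply: cvgD; first exact: cvg_cst.
    apply: cvgM; first exact: cvg_cst.
    by apply: cvgB; [apply: cvgD => //; exact: cvg_cst|exact: cvg_cst].
  apply: cvgD; first exact: cvg_cst.
  apply: cvgM; first exact: cvg_cst.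
  by apply: cvgB; [apply: cvgD => //; exact: cvg_cst|exact: cvg_cst].
have [_ [f0 f1]] := fB (segment_in_ball x t12).
split.
  exact: (@continuous_comp _ _ _ (fun y => (g1 t y, g2 t y)) (fun w => re (f' w)) x gc f0).
exact: (@continuous_comp _ _ _ (fun y => (g1 t y, g2 t y)) (fun w => im (f' w)) x gc f1).
Qed.

Let J t := circle_int (fun x => re (f (g1 t x, g2 t x) * K x)).

Lemma radial_bound (t x : R) : -1 < t < 2 ->
  `|re (f' (g1 t x, g2 t x) * circle_vec r x)| <= M * r + M * r.
Proof.
move=> t12; have [f0 f1] := fM (segment_in_ball x t12).
have r1 := ltW r0; rewrite reM (le_trans (ler_normB _ _))// !normrM /=.
have cr : `|cos x| * r <= 1 * r by rewrite ler_wpM2r// cos_max.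
have sr : `|sin x| * r <= 1 * r by rewrite ler_wpM2r// sin_max.
rewrite (ger0_norm r1) ![r * _]mulrC.
by rewrite lerD// ler_pM ?mulr_ge0// -[leRHS]mul1r.
Qed.

Lemma continuous_integrand (t : R) : -1 < t < 2 ->
  continuous (fun x => re (f (g1 t x, g2 t x) * K x)) /\
  continuous (fun x => re (f' (g1 t x, g2 t x) * circle_vec r x)).
Proof.
move=> t12; split=> x; have [c1 c2] := ccont_angular x t12.
  by have [] := ccontM c1 (ccont_kernel x).
by have [/ccont_derivable e /e /(ccontM c2)[]] := is_derive_circle_vec r x.
Qed.

Lemma is_derive_radial_int (t : R) : -1 < t < 2 ->
  is_derive t 1 J (circle_int (fun x => re (f' (g1 t x, g2 t x) * circle_vec r x))).
Proof.
move=> t12.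
pose F (s x : R) := re (f (g1 s x, g2 s x) * K x).
have mI : measurable (`[0, 2 * pi] : set (measurableTypeR R)) by [].
have tI : `](-1), 2[%classic t by rewrite /= in_itv.
have intF s : `](-1), 2[%classic s ->
    (@lebesgue_measure R).-integrable `[0, 2 * pi] (EFin \o F s).
  rewrite /= in_itv/= => s12; apply: circle_int_integrable.
  by have [] := continuous_integrand s12.
have derF (s x : R) : `](-1), 2[%classic s -> `[0, 2 * pi]%classic x ->
    derivable (F ^~ x) s 1.
  by rewrite /= in_itv/= => /(derive_radial x) [].
have intG : (@lebesgue_measure R).-integrable `[0, 2 * pi] (EFin \o cst (M * r + M * r)).
  by apply: circle_int_integrable => x; exact: cvg_cst.
have E (s x : R) : -1 < s < 2 -> partial1of2 F s x = re (f' (g1 s x, g2 s x) * circle_vec r x).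
  by move=> /(derive_radial x) d; rewrite partial1of2E derive_val.
have G0 (x : R) : 0 <= cst (M * r + M * r) x.
  by rewrite /= (le_trans _ (radial_bound 0 t12)).
have GF (s x : R) : `](-1), 2[%classic s -> `[0, 2 * pi]%classic x ->
    `|partial1of2 F s x| <= cst (M * r + M * r) x.
  by rewrite /= in_itv/= => s12 _; rewrite E// radial_bound.
apply: DeriveDef.
  by have := derivable_under_integral mI tI intF derF G0 intG GF.
rewrite -derive1E (differentiation_under_integral mI tI intF derF G0 intG GF).
by apply: eq_Rintegral => x _; exact: E.
Qed.

Lemma circle_intZ (k : R) (g : R -> R) : continuous g -> circle_int (fun x => k * g x) = k * circle_int g.
Proof. by move=> cg; rewrite /circle_int RintegralZl//; exact: circle_int_integrable. Qed.

(** The derivative in [t] of the integral is, up to the factor [t], the integral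
over a period of an angular derivative, hence zero. *)
Lemma radial_int_const : J 1 = J 0.
Proof.
have := @MVT _ J (fun t => circle_int (fun x => re (f' (g1 t x, g2 t x) * circle_vec r x))) 0 1.
case=> //.
- by move=> t /[!in_itv]/= ?; apply: is_derive_radial_int; lra.
- apply: derivable_within_continuous => t /[!in_itv]/= ?.
  have t12 : -1 < t < 2 by lra.
  by have [] := is_derive_radial_int t12.
move=> t /[!in_itv]/= t01; have t12 : -1 < t < 2 by lra.
have [_ ct] := continuous_integrand t12.
have := circle_int_derive (g := fun y => im (f (g1 t y, g2 t y)))
  (g' := fun x => t * re (f' (g1 t x, g2 t x) * circle_vec r x)).
rewrite circle_intZ// => /(_ _ _)/eqP.
rewrite /g1 /g2 cos0 sin0 mulr_natl cos2pi sin2pi subrr mulf_eq0 => e.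
have /orP[/eqP t0|/eqP e0] : (t == 0) || (circle_int (fun x => re (f' (g1 t x, g2 t x) * circle_vec r x)) == 0).
  apply: e.
    by move=> x; apply: cvgM; [exact: cvg_cst|exact: ct].
  by move=> x; have [] := derive_angular x t12.
  by move: t01; rewrite t0 ltxx.
by rewrite e0 mul0r => /subr0_eq.
Qed.

(** Contracting the circle around [c] to the point [z] does not change the
integral: [t = 1] is the circle and [t = 0] is the point. *)
Lemma cauchy_re : circle_int (fun x => re (f (c.1 + r * cos x, c.2 + r * sin x) * K x)) =
  circle_int (fun x => re (f z * K x)).
Proof.
transitivity (J 1).
  by congr circle_int; apply/funext => x; rewrite /g1 /g2; congr (re (f (_, _) * _)); ring.
rewrite radial_int_const; congr circle_int; apply/funext => x; rewrite /g1 /g2 !mul0r !addr0.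
by case: (z).
Qed.

End circle.
End CauchyCore.

(** * Calculus of holomorphic functions *)

Section CrTheory.
Variable R : realType.
Local Notation C := (R[i]).
Implicit Types (z w : R * R) (u v : R * R -> R) (f g : R * R -> C).

Lemma has_gradD u v z a b a' b' : has_grad u z a b -> has_grad v z a' b' ->
  has_grad (fun w => u w + v w) z (a + a') (b + b').
Proof. by move=> [u1 u2] [v1 v2]; split; exact: is_deriveD. Qed.

Lemma has_gradN u z a b : has_grad u z a b -> has_grad (fun w => - u w) z (- a) (- b).
Proof. by move=> [u1 u2]; split; exact: is_deriveN. Qed.

Lemma has_gradB u v z a b a' b' : has_grad u z a b -> has_grad v z a' b' ->
  has_grad (fun w => u w - v w) z (a - a') (b - b').
Proof. by move=> du /has_gradN; exact: has_gradD. Qed.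

Lemma has_gradM u v z a b a' b' : has_grad u z a b -> has_grad v z a' b' ->
  has_grad (fun w => u w * v w) z (u z * a' + v z * a) (u z * b' + v z * b).
Proof. by move=> [u1 u2] [v1 v2]; split; exact: is_deriveM. Qed.

Lemma has_gradV u z a b : u z != 0 -> has_grad u z a b ->
  has_grad (fun w => (u w)^-1) z (- (u z) ^- 2 * a) (- (u z) ^- 2 * b).
Proof.
move=> u0 [[u1 <-] [u2 <-]]; split.
  apply: DeriveDef; first exact: (derivableV u0 u1).
  rewrite (deriveV u0 u1) /GRing.scale /=; reflexivity.
apply: DeriveDef; first exact: (derivableV u0 u2).
rewrite (deriveV u0 u2) /GRing.scale /=; reflexivity.
Qed.

Lemma has_grad_eq u z a b a' b' : has_grad u z a b -> a = a' -> b = b' ->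
  has_grad u z a' b'.
Proof. by move=> ? <- <-. Qed.

Lemma has_grad_cst (k : R) z : has_grad (fun=> k) z 0 0.
Proof. by split; exact: is_derive_cst. Qed.

(** The identification of the plane of the stem domains with the complex numbers. *)
Definition cplx z : C := Complex z.1 z.2.

Lemma has_cderiv_cst (k : C) z : has_cderiv (fun=> k) (fun=> 0) z.
Proof. by split; rewrite /= ?oppr0; exact: has_grad_cst. Qed.

Lemma has_cderiv_cplx z : has_cderiv cplx (fun=> 1) z.
Proof.
case: z => a b; split; split => /=; rewrite ?oppr0.
- by apply/is_derive_fst; exact: is_derive_id.
- by apply/is_derive_snd; exact: is_derive_cst.
- by apply/is_derive_fst; exact: is_derive_cst.
- by apply/is_derive_snd; exact: is_derive_id.
Qed.

Lemma has_cderivD f f' g g' z : has_cderiv f f' z -> has_cderiv g g' z ->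
  has_cderiv (fun w => f w + g w) (fun w => f' w + g' w) z.
Proof.
move=> [f0 f1] [g0 g1]; split; rewrite reD imD ?opprD.
  by under eq_fun do rewrite reD; exact: has_gradD.
by under eq_fun do rewrite imD; exact: has_gradD.
Qed.

Lemma has_cderivN f f' z : has_cderiv f f' z -> has_cderiv (fun w => - f w) (fun w => - f' w) z.
Proof.
move=> [f0 f1]; split; rewrite reN imN.
  by under eq_fun do rewrite reN; exact: has_gradN.
by under eq_fun do rewrite imN; exact: has_gradN.
Qed.

Lemma has_cderivM f f' g g' z : has_cderiv f f' z -> has_cderiv g g' z ->
  has_cderiv (fun w => f w * g w) (fun w => f' w * g w + f w * g' w) z.
Proof.
move=> [f0 f1] [g0 g1]; split; rewrite !(reM, imM, reD, imD).
  under eq_fun do rewrite reM.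
  by apply: has_grad_eq (has_gradB (has_gradM f0 g0) (has_gradM f1 g1)) _ _; ring.
under eq_fun do rewrite imM.
by apply: has_grad_eq (has_gradD (has_gradM f0 g1) (has_gradM f1 g0)) _ _; ring.
Qed.

(** The gradient of the inverse is computed from that of the squared modulus. *)
Lemma has_cderivV f f' z : f z != 0 -> has_cderiv f f' z ->
  has_cderiv (fun w => (f w)^-1) (fun w => - (f w) ^- 2 * f' w) z.
Proof.
move=> fz0 [f0 f1]; have n0 := sqr_re_im_neq0 fz0.
have dn := has_gradD (has_gradM f0 f0) (has_gradM f1 f1).
have dV := has_gradV n0 dn.
have E : - (f z) ^- 2 = - ((f z)^-1 * (f z)^-1) by rewrite expr2 invfM.
split; rewrite E !(reM, imM, reN, imN, reV, imV).
  under eq_fun do rewrite reV !expr2.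
  by apply: has_grad_eq (has_gradM f0 dV) _ _; field.
under eq_fun do rewrite imV !expr2.
by apply: has_grad_eq (has_gradN (has_gradM f1 dV)) _ _; field.
Qed.

Lemma near_has_cderiv f g f' z : (\near z, f z = g z) -> has_cderiv f f' z -> has_cderiv g f' z.
Proof.
move=> fg [[f1 f2] [f3 f4]]; split; split;
  by [apply: near_eq_is_derive f1; apply: filterS fg => ? ->
     |apply: near_eq_is_derive f2; apply: filterS fg => ? ->
     |apply: near_eq_is_derive f3; apply: filterS fg => ? ->
     |apply: near_eq_is_derive f4; apply: filterS fg => ? ->].
Qed.

Lemma has_grad_continuous u p q z : (\forall w \near z, has_grad u w (p w) (q w)) ->
  {for z, continuous p} -> {for z, continuous q} -> {for z, continuous u}.
Proof.
move=> du cp cq; have [dd _] := C1_is_diff du cp cq.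
exact: differentiable_continuous.
Qed.

Lemma holo_at_ccont f z : holo_at f z -> ccont f z.
Proof.
move=> [f' ff']; have [_ [c0 c1]] := nbhs_singleton ff'; split.
  apply: (@has_grad_continuous _ (fun w => re (f' w)) (fun w => - im (f' w))) => //.
    by apply: filterS ff' => w [[]].
  exact: cvgN.
apply: (@has_grad_continuous _ (fun w => im (f' w)) (fun w => re (f' w))) => //.
by apply: filterS ff' => w [[]].
Qed.

Lemma holo_at_near f z : holo_at f z -> \forall w \near z, holo_at f w.
Proof.
by move=> [f' ff']; apply: filterS (near_join ff') => w wf; exists f'.
Qed.

Lemma holo_at_cst (k : C) z : holo_at (fun=> k) z.
Proof.
by exists (fun=> 0); near=> w; split; [exact: has_cderiv_cst|exact: ccont_cst].
Unshelve. all: by end_near. Qed.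

Lemma holo_at_cplx z : holo_at cplx z.
Proof.
by exists (fun=> 1); near=> w; split; [exact: has_cderiv_cplx|exact: ccont_cst].
Unshelve. all: by end_near. Qed.

Lemma holo_atD f g z : holo_at f z -> holo_at g z -> holo_at (fun w => f w + g w) z.
Proof.
move=> [f' ff'] [g' gg']; exists (fun w => f' w + g' w); near=> w.
have [f1 f2] : has_cderiv f f' w /\ ccont f' w by near: w.
have [g1 g2] : has_cderiv g g' w /\ ccont g' w by near: w.
by split; [exact: has_cderivD|exact: ccontD].
Unshelve. all: by end_near. Qed.

Lemma holo_atM f g z : holo_at f z -> holo_at g z -> holo_at (fun w => f w * g w) z.
Proof.
move=> hf hg; have hf' := holo_at_near hf; have hg' := holo_at_near hg.
case: hf hg => [f' ff'] [g' gg']; exists (fun w => f' w * g w + f w * g' w); near=> w.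
have [f1 f2] : has_cderiv f f' w /\ ccont f' w by near: w.
have [g1 g2] : has_cderiv g g' w /\ ccont g' w by near: w.
split; first exact: has_cderivM.
apply: ccontD; apply: ccontM => //; apply: holo_at_ccont.
  by near: w.
by near: w.
Unshelve. all: by end_near. Qed.

Lemma ccont_neq0 (T : topologicalType) (h : T -> C) t : ccont h t -> h t != 0 ->
  \forall s \near t, h s != 0.
Proof.
move=> [h0 h1] /sqr_re_im_neq0 ht.
have n0 : (fun s => re (h s) ^+ 2 + im (h s) ^+ 2) @ t -->
    (re (h t) ^+ 2 + im (h t) ^+ 2).
  by apply: cvgD; rewrite !expr2; apply: cvgM.
have : \forall s \near t, re (h s) ^+ 2 + im (h s) ^+ 2 != 0.
  have := n0 _ (open_nbhs_nbhs (conj (@open_neq _ (0:R)) ht)).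
  by [].
by apply: filterS => s; apply: contra => /eqP ->; rewrite /= !expr0n/= addr0.
Qed.

Lemma holo_atV f z : f z != 0 -> holo_at f z -> holo_at (fun w => (f w)^-1) z.
Proof.
move=> fz hf; have hf' := holo_at_near hf; have f0 := ccont_neq0 (holo_at_ccont hf) fz.
case: hf => [f' ff']; exists (fun w => - (f w) ^- 2 * f' w); near=> w.
have [f1 f2] : has_cderiv f f' w /\ ccont f' w by near: w.
have fw0 : f w != 0 by near: w.
have cf : ccont f w by apply: holo_at_ccont; near: w.
split; first exact: has_cderivV.
apply: ccontM => //; apply: ccontN; apply: ccontV; last by rewrite expf_neq0.
by under [X in ccont X]eq_fun do rewrite expr2; exact: ccontM.
Unshelve. all: by end_near. Qed.

Lemma holo_at_eq f g z : (\near z, f z = g z) -> holo_at f z -> holo_at g z.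
Proof.
move=> /near_join fg [f' ff']; exists f'; near=> w.
have [f1 f2] : has_cderiv f f' w /\ ccont f' w by near: w.
by split => //; apply: near_has_cderiv f1; near: w.
Unshelve. all: by end_near. Qed.

End CrTheory.

(** * Differentiability from quadratic remainders *)

Section Quad.
Variable R : realType.
Local Notation C := (R[i]).
Implicit Types (z w : R * R) (f g : R * R -> C).

Lemma normc_sqr (x : C) : normc x ^+ 2 = re x ^+ 2 + im x ^+ 2.
Proof. by case: x => a b; rewrite /normc sqr_sqrtr// addr_ge0 ?sqr_ge0. Qed.

Lemma normc_ge0 (x : C) : 0 <= normc x.
Proof. by case: x => a b; exact: sqrtr_ge0. Qed.

Lemma normr_re (x : C) : `|re x| <= normc x.
Proof. by case: x => a b; rewrite /= -sqrtr_sqr ler_wsqrtr// lerDl sqr_ge0. Qed.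

Lemma normr_im (x : C) : `|im x| <= normc x.
Proof. by case: x => a b; rewrite /= -sqrtr_sqr ler_wsqrtr// lerDr sqr_ge0. Qed.

Lemma normc_le (x : C) : normc x <= `|re x| + `|im x|.
Proof.
rewrite -(@ler_pXn2r _ 2)// ?nnegrE ?addr_ge0 ?normc_ge0//.
rewrite normc_sqr sqrrD !real_normK ?num_real// -addrA lerD2l lerDr.
by rewrite mulrn_wge0// mulr_ge0.
Qed.

Lemma normcX (x : C) n : normc (x ^+ n) = normc x ^+ n.
Proof. by elim: n => [|n IH]; rewrite ?expr0 ?normc1// !exprS normcM IH. Qed.

Lemma is_derive_quad (g : R -> R) (x d L e : R) : 0 < e ->
  (forall y, `|y - x| < e -> `|g y - g x - (y - x) * d| <= L * (y - x) ^+ 2) ->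
  is_derive x 1 g d.
Proof.
move=> e0 H.
suff cv : h^-1 *: ((g \o shift x) (h *: 1) - g x) @[h --> 0^'] --> d.
  by apply: DeriveDef; [apply/cvg_ex; exists d|exact: cvg_lim].
apply/cvgrPdist_le => eps eps0; near=> h.
have h0 : h != 0 by near: h; exact: nbhs_dnbhs_neq.
have he : `|h| < e by near: h; exact: dnbhs0_lt.
have hL : `|h| < eps / (`|L| + 1).
  by near: h; apply: dnbhs0_lt; rewrite divr_gt0// ltr_wpDl.
have := H (h + x); rewrite addrK => /(_ he) Hh.
rewrite /= /GRing.scale/= mulr1 -normrN opprB.
have -> : h^-1 * (g (h + x) - g x) - d = h^-1 * (g (h + x) - g x - h * d).
  by rewrite [RHS]mulrBr mulKf.
rewrite normrM normfV ler_pdivrMl ?normr_gt0//.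
apply: (le_trans Hh); rewrite -real_normK ?num_real// expr2 mulrCA ler_wpM2l//.
have : L * `|h| <= (`|L| + 1) * `|h| by rewrite ler_wpM2r// ler_wpDr// ler_norm.
move=> /le_trans; apply; rewrite mulrC -ler_pdivlMr ?ltr_wpDl//; exact: ltW.
Unshelve. all: by end_near. Qed.

(** A quadratic bound on the remainder gives the complex derivative without any
limit of integrals having to be exchanged. *)
Lemma has_cderiv_quad f f' z (L e : R) : 0 < e ->
  (forall w, ball z e w -> normc (f w - f z - (cplx w - cplx z) * f' z) <=
     L * normc (cplx w - cplx z) ^+ 2) -> has_cderiv f f' z.
Proof.
case: z => a b e0 H.
have H1 y : `|y - a| < e -> normc (f (y, b) - f (a, b) - Complex (y - a) 0 * f' (a, b))
    <= L * (y - a) ^+ 2.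
  move=> ya; have := H (y, b).
  have -> : cplx (y, b) - cplx (a, b) = Complex (y - a) 0.
    by apply: complex_eq; rewrite !(reD, imD, reN, imN) //= subrr.
  rewrite normc_sqr /= expr0n addr0; apply.
  by apply/ball_pairE; rewrite /= subrr normr0 distrC.
have H2 y : `|y - b| < e -> normc (f (a, y) - f (a, b) - Complex 0 (y - b) * f' (a, b))
    <= L * (y - b) ^+ 2.
  move=> ya; have := H (a, y).
  have -> : cplx (a, y) - cplx (a, b) = Complex 0 (y - b).
    by apply: complex_eq; rewrite !(reD, imD, reN, imN) //= subrr.
  rewrite normc_sqr /= expr0n add0r; apply.
  by apply/ball_pairE; rewrite /= subrr normr0 distrC.
split; split.
- apply/is_derive_fst/(is_derive_quad (L := L) e0) => y /H1; apply: le_trans.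
  by apply: le_trans (normr_re _); rewrite !(reD, reN, reM) /= mul0r subr0.
- apply/is_derive_snd/(is_derive_quad (L := L) e0) => y /H2; apply: le_trans.
  by apply: le_trans (normr_re _); rewrite !(reD, reN, reM) /= mul0r sub0r mulrN.
- apply/is_derive_fst/(is_derive_quad (L := L) e0) => y /H1; apply: le_trans.
  by apply: le_trans (normr_im _); rewrite !(imD, imN, imM) /= mul0r addr0.
- apply/is_derive_snd/(is_derive_quad (L := L) e0) => y /H2; apply: le_trans.
  by apply: le_trans (normr_im _); rewrite !(imD, imN, imM) /= mul0r add0r.
Qed.

Lemma ccont_lip f z (L e : R) : 0 < e ->
  (forall w, ball z e w -> normc (f w - f z) <= L * normc (cplx w - cplx z)) -> ccont f z.
Proof.
move=> e0 H.
have near_small (eps : R) : 0 < eps -> \forall w \near z, normc (f w - f z) <= eps.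
  move=> eps0; pose d := Num.min e (eps / (2 * (`|L| + 1))).
  have L1 : 0 < `|L| + 1 by rewrite ltr_wpDl.
  have d0 : 0 < d by rewrite lt_min e0 divr_gt0// mulr_gt0.
  have : \forall w \near z, ball z d w by exact: nbhsx_ballx.
  apply: filterS => w wd; have we : ball z e w.
    by apply: le_ball wd; rewrite /d ge_min lexx.
  apply: (le_trans (H _ we)).
  have : normc (cplx w - cplx z) <= eps / (`|L| + 1).
    have /ball_pairE[w1 w2] : ball z (eps / (2 * (`|L| + 1))) w.
      by apply: le_ball wd; rewrite /d ge_min lexx orbT.
    apply: (le_trans (normc_le _)); rewrite /= distrC [`|w.2 - _|]distrC.
    apply: (le_trans (ltW (ltrD w1 w2))); rewrite le_eqVlt; apply/orP; left; apply/eqP.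
    by field; rewrite gt_eqF.
  move=> h; have : L * normc (cplx w - cplx z) <= (`|L| + 1) * normc (cplx w - cplx z).
    by rewrite ler_wpM2r ?normc_ge0// ler_wpDr// ler_norm.
  by move=> /le_trans; apply; rewrite mulrC -ler_pdivlMr.
split; apply/cvgrPdist_le => eps /near_small; apply: filterS => w; apply: le_trans.
  by rewrite distrC -reN -reD; exact: normr_re.
by rewrite distrC -imN -imD; exact: normr_im.
Qed.

End Quad.

(** * Integrals against the Cauchy kernel *)

Section Kernel.
Variable R : realType.
Local Notation C := (R[i]).
Implicit Types (z w : R * R) (p q : R -> C).
Local Notation mu := (@lebesgue_measure R).

Definition ccontT p := forall x, ccont p x.

Definition circle_cint p : C := Complex (circle_int (fun x => re (p x))) (circle_int (fun x => im (p x))).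

Lemma circle_intD (g h : R -> R) : continuous g -> continuous h ->
  circle_int (fun x => g x + h x) = circle_int g + circle_int h.
Proof. by move=> cg ch; rewrite /circle_int RintegralD//; exact: circle_int_integrable. Qed.

Lemma circle_intN (g : R -> R) : continuous g -> circle_int (fun x => - g x) = - circle_int g.
Proof.
move=> cg; have := circle_intZ (-1) cg; rewrite mulN1r => <-; congr circle_int.
by apply/funext => x; rewrite mulN1r.
Qed.

Lemma circle_cintD p q : ccontT p -> ccontT q -> circle_cint (fun x => p x + q x) = circle_cint p + circle_cint q.
Proof.
move=> cp cq; apply: complex_eq; rewrite ?(reD, imD) /= -circle_intD.
- by congr circle_int; apply/funext => x; rewrite reD.
- by move=> x; have [] := cp x.
- by move=> x; have [] := cq x.
- by congr circle_int; apply/funext => x; rewrite imD.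
- by move=> x; have [] := cp x.
- by move=> x; have [] := cq x.
Qed.

Lemma circle_cintZ (k : C) p : ccontT p -> circle_cint (fun x => k * p x) = k * circle_cint p.
Proof.
move=> cp; have c0 : continuous (fun x => re (p x)) by move=> x; have [] := cp x.
have c1 : continuous (fun x => im (p x)) by move=> x; have [] := cp x.
have cZ (a : R) (g : R -> R) : continuous g -> continuous (fun x => a * g x).
  by move=> cg x; apply: cvgM; [exact: cvg_cst|exact: cg].
apply: complex_eq; rewrite ?(reM, imM) /= -!circle_intZ//.
  rewrite -circle_intN; last exact: cZ.
  rewrite -circle_intD; [|exact: cZ|by move=> x; apply: cvgN; exact: cZ].
  by congr circle_int; apply/funext => x; rewrite reM.
rewrite -circle_intD; [|exact: cZ|exact: cZ].
by congr circle_int; apply/funext => x; rewrite imM.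
Qed.

Lemma circle_cintN p : ccontT p -> circle_cint (fun x => - p x) = - circle_cint p.
Proof.
move=> cp; rewrite -mulN1r -circle_cintZ//; congr circle_cint; apply/funext => x.
by rewrite mulN1r.
Qed.

Lemma circle_int_le (g : R -> R) (B : R) : continuous g -> (forall x, `|g x| <= B) ->
  `|circle_int g| <= 2 * pi * B.
Proof.
move=> cg gB; have ig := circle_int_integrable cg.
have pi2 : 0 <= 2 * pi :> R by rewrite mulr_ge0// pi_ge0.
apply: (le_trans (le_normr_Rintegral _ ig)) => //.
have icst : mu.-integrable `[0, 2 * pi] (EFin \o cst B).
  by apply: circle_int_integrable => x; exact: cvg_cst.
have -> : 2 * pi * B = \int[mu]_(x in `[0, 2 * pi]) cst B x.
  have cB : continuous (cst B : R -> R) by move=> x; exact: cvg_cst.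
  by have := circle_int_derive cB (is_derive_affine 0 B); rewrite /circle_int !add0r mul0r subr0.
apply: le_Rintegral => //; first exact: (integrable_norm ig).
Qed.

Lemma circle_cint_le p (B : R) : ccontT p -> (forall x, normc (p x) <= B) ->
  normc (circle_cint p) <= 4 * pi * B.
Proof.
move=> cp pB; apply: (le_trans (normc_le _)); rewrite /=.
have -> : 4 * pi * B = 2 * pi * B + 2 * pi * B by ring.
apply: lerD; apply: circle_int_le => x; have [c0 c1] := cp x => //.
  exact: le_trans (normr_re _) _.
exact: le_trans (normr_im _) _.
Qed.

Lemma ccontTM p q : ccontT p -> ccontT q -> ccontT (fun x => p x * q x).
Proof. by move=> cp cq x; exact: ccontM. Qed.
Lemma ccontTD p q : ccontT p -> ccontT q -> ccontT (fun x => p x + q x).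
Proof. by move=> cp cq x; exact: ccontD. Qed.
Lemma ccontTN p : ccontT p -> ccontT (fun x => - p x).
Proof. by move=> cp x; exact: ccontN. Qed.
Lemma ccontTV p : ccontT p -> (forall x, p x != 0) -> ccontT (fun x => (p x)^-1).
Proof. by move=> cp p0 x; exact: ccontV. Qed.
Lemma ccontT_cst (k : C) : ccontT (fun=> k).
Proof. by move=> x; exact: ccont_cst. Qed.

Lemma ccontT_circle_vec (r : R) : ccontT (circle_vec r).
Proof. by move=> x; have [/ccont_derivable e /e] := is_derive_circle_vec r x. Qed.

Section kernel.
Variables (p : R -> C) (c : R * R) (r B : R).
Hypothesis r0 : 0 < r.
Hypothesis cp : ccontT p.
Hypothesis pB : forall x, normc (p x) <= B.

Let D w x : C := circle_vec r x - (cplx w - cplx c).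

Lemma normc_circle_vec x : normc (circle_vec r x) = r.
Proof.
have e : normc (circle_vec r x) ^+ 2 = r ^+ 2.
  by rewrite normc_sqr /= !exprMn -mulrDr cos2Dsin2 mulr1.
apply/eqP; rewrite -(@eqrXn2 _ 2)// ?normc_ge0 ?e ?eqxx//; exact: ltW.
Qed.

Lemma normc_center w : ball c (r / 2) w -> normc (cplx w - cplx c) <= 3 / 4 * r.
Proof.
move=> /ball_pairE[w1 w2]; have r1 := r0.
rewrite -(@ler_pXn2r _ 2)// ?nnegrE ?normc_ge0//; last by lra.
rewrite normc_sqr /=.
rewrite distrC in w1; rewrite distrC in w2.
have q1 : (w.1 - c.1) ^+ 2 < (r / 2) ^+ 2.
  by rewrite -real_normK ?num_real// ltr_sqr ?nnegrE ?normr_ge0//; lra.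
have q2 : (w.2 - c.2) ^+ 2 < (r / 2) ^+ 2.
  by rewrite -real_normK ?num_real// ltr_sqr ?nnegrE ?normr_ge0//; lra.
nra.
Qed.

Lemma normc_den w x : ball c (r / 2) w -> r / 4 <= normc (D w x) <= 2 * r.
Proof.
move=> /normc_center cw; have r1 := r0; have ex := normc_circle_vec x.
have := le_normcD (D w x) (cplx w - cplx c); rewrite /D subrK ex.
have := le_normcD (circle_vec r x) (- (cplx w - cplx c)); rewrite ex normcN.
by move=> h1 h2; apply/andP; split; lra.
Qed.

Lemma den_neq0 w x : ball c (r / 2) w -> D w x != 0.
Proof.
move=> wr; have /andP[+ _] := normc_den x wr; apply: contraTneq => ->.
by rewrite normc0 -ltNge divr_gt0.
Qed.

Lemma ccontT_den w : ccontT (D w).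
Proof. by apply: ccontTD; [exact: ccontT_circle_vec|exact: ccontT_cst]. Qed.

Lemma ccontT_denV w : ball c (r / 2) w -> ccontT (fun x => (D w x)^-1).
Proof. by move=> wr; apply: ccontTV; [exact: ccontT_den|move=> x; exact: den_neq0]. Qed.

Lemma normc_denV w x : ball c (r / 2) w -> normc (D w x)^-1 <= 4 / r.
Proof.
move=> wr; have r1 := r0; have /andP[d1 _] := normc_den x wr.
rewrite normcV -[4 / r]invrK lef_pV2 ?posrE ?invr_gt0 ?divr_gt0// ?invf_div//.
by apply: lt_le_trans d1; rewrite divr_gt0.
Qed.

(** [cauchy_int1] and [cauchy_int2] integrate [p] against the first and second
power of the Cauchy kernel; the second is the derivative of the first. *)
Definition cauchy_int1 w := circle_cint (fun x => p x * (D w x)^-1).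
Definition cauchy_int2 w := circle_cint (fun x => p x * ((D w x)^-1 * (D w x)^-1)).

(** The difference of kernels satisfies an exact algebraic identity, so that the
remainder of the expansion at [z] is itself an integral, with an explicit
factor [(w - z)^2]. *)
Lemma cauchy_int1_quad z w : ball c (r / 2) z -> ball c (r / 2) w ->
  cauchy_int1 w - cauchy_int1 z - (cplx w - cplx z) * cauchy_int2 z =
  (cplx w - cplx z) ^+ 2 * circle_cint (fun x => p x * ((D w x)^-1 * ((D z x)^-1 * (D z x)^-1))).
Proof.
move=> zr wr; have cz := ccontT_denV zr; have cw := ccontT_denV wr.
have c1 := ccontTM cp cw; have c2 := ccontTM cp cz; have czz := ccontTM cz cz.
have c3 := ccontTM cp czz; have c4 := ccontTM cp (ccontTM cw czz).
have c3' := ccontTM (ccontT_cst (cplx w - cplx z)) c3.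
rewrite -(circle_cintZ _ c4) /cauchy_int1 /cauchy_int2 -(circle_cintZ _ c3) -(circle_cintN c2) -(circle_cintD c1 (ccontTN c2)).
rewrite -(circle_cintN c3') -(circle_cintD (ccontTD c1 (ccontTN c2)) (ccontTN c3')).
congr circle_cint; apply/funext => x.
have dz := den_neq0 x zr; have dw := den_neq0 x wr.
have -> : cplx w - cplx z = D z x - D w x by rewrite /D; ring.
by field; rewrite dz dw.
Qed.

Lemma cauchy_int2_lip z w : ball c (r / 2) z -> ball c (r / 2) w ->
  cauchy_int2 w - cauchy_int2 z = (cplx w - cplx z) *
    circle_cint (fun x => p x * ((D z x + D w x) *
      (((D w x)^-1 * (D w x)^-1) * ((D z x)^-1 * (D z x)^-1)))).
Proof.
move=> zr wr; have cz := ccontT_denV zr; have cw := ccontT_denV wr.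
have czz := ccontTM cz cz; have cww := ccontTM cw cw.
have c1 := ccontTM cp cww; have c2 := ccontTM cp czz.
have c3 := ccontTM cp (ccontTM (ccontTD (ccontT_den z) (ccontT_den w)) (ccontTM cww czz)).
rewrite -(circle_cintZ _ c3) /cauchy_int2 -(circle_cintN c2) -(circle_cintD c1 (ccontTN c2)).
congr circle_cint; apply/funext => x.
have dz := den_neq0 x zr; have dw := den_neq0 x wr.
have -> : cplx w - cplx z = D z x - D w x by rewrite /D; ring.
by field; rewrite dz dw.
Qed.

(** On the half-size ball the denominators are at least [r / 4] in modulus, which
turns the two algebraic identities into quadratic and Lipschitz bounds. *)
Lemma cauchy_int1_cderiv z : ball c (r / 2) z -> has_cderiv cauchy_int1 cauchy_int2 z /\ ccont cauchy_int2 z.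
Proof.
move=> zr; have r1 := r0.
have pi0 : 0 < pi :> R by exact: pi_gt0.
have B0 : 0 <= B by apply: le_trans (pB 0); exact: normc_ge0.
have i0 : 0 <= 4 / r by rewrite divr_ge0// ltW.
have near_r : exists2 e : R, 0 < e & forall w, ball z e w -> ball c (r / 2) w.
  have /nbhs_ballP[e e0 ze] : \forall w \near z, ball c (r / 2) w.
    by apply: open_nbhs_nbhs; split => //; apply: ball_open; lra.
  by exists e.
case: near_r => e e0 ze; have cz := ccontT_denV zr; split.
  apply: (@has_cderiv_quad _ _ _ _ (4 * pi * (B * (4 / r * (4 / r * (4 / r))))) e) => // w /ze wr.
  have cw := ccontT_denV wr.
  rewrite cauchy_int1_quad// normcM normcX mulrC ler_wpM2r ?sqr_ge0//.
  apply: circle_cint_le => [|x]; first exact: (ccontTM cp (ccontTM cw (ccontTM cz cz))).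
  by rewrite !normcM !ler_pM ?mulr_ge0 ?normc_ge0// normc_denV.
apply: (@ccont_lip _ _ _ (4 * pi * (B * ((2 * r + 2 * r) *
  (4 / r * (4 / r) * (4 / r * (4 / r)))))) e) => // w /ze wr.
have cw := ccontT_denV wr.
rewrite cauchy_int2_lip// normcM mulrC ler_wpM2r ?normc_ge0//.
apply: circle_cint_le => [|x].
  exact: (ccontTM cp (ccontTM (ccontTD (ccontT_den z) (ccontT_den w)) (ccontTM (ccontTM cw cw) (ccontTM cz cz)))).
rewrite !normcM !ler_pM ?mulr_ge0 ?normc_ge0 ?normc_denV//.
apply: (le_trans (le_normcD _ _)).
have /andP[_ d1] := normc_den x zr; have /andP[_ d2] := normc_den x wr.
exact: lerD.
Qed.

Lemma cauchy_int1_holo : holo_at cauchy_int1 c.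
Proof.
exists cauchy_int2; have : \forall w \near c, ball c (r / 2) w.
  by apply: nbhsx_ballx; rewrite divr_gt0.
by apply: filterS => w /cauchy_int1_cderiv.
Qed.

End kernel.
End Kernel.

(** * Dividing out a zero *)

Section Division.
Variable R : realType.
Local Notation C := (R[i]).
Implicit Types (z w c : R * R) (f : R * R -> C).

Definition circle_pt c (r x : R) : R * R := (c.1 + r * cos x, c.2 + r * sin x).

(** The imaginary part is the real part for [- i f], which satisfies the same
hypotheses. *)
Lemma cauchy_circle (f f' : R * R -> C) (c z : R * R) (r M : R) : 0 < r ->
  (forall w, ball c (4 * r) w -> has_cderiv f f' w /\ ccont f' w) ->
  (forall w, ball c (4 * r) w -> `|re (f' w)| <= M /\ `|im (f' w)| <= M) ->
  ball c (r / 2) z ->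
  circle_cint (fun x => f (circle_pt c r x) * (circle_vec r x / (circle_vec r x - (cplx z - cplx c)))) =
  f z * circle_cint (fun x => circle_vec r x / (circle_vec r x - (cplx z - cplx c))).
Proof.
move=> r0 fB fM zr.
have E : cplx z - cplx c = Complex (z.1 - c.1) (z.2 - c.2) by apply: complex_eq; rewrite ?reD ?imD ?reN ?imN.
have cK : ccontT (fun x => circle_vec r x / (circle_vec r x - (cplx z - cplx c))).
  by apply: ccontTM; [exact: ccontT_circle_vec|exact: ccontT_denV].
rewrite -(circle_cintZ _ cK).
apply: complex_eq => /=; rewrite E; first exact: (cauchy_re r0 fB fM zr).
pose k : C := Complex 0 (-1).
have kB w : ball c (4 * r) w ->
    has_cderiv (fun w => k * f w) (fun w => k * f' w) w /\ ccont (fun w => k * f' w) w.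
  move=> /fB[crf cf']; split; last by apply: ccontM => //; exact: ccont_cst.
  by have := has_cderivM (has_cderiv_cst k w) crf; rewrite /has_cderiv !mul0r !add0r.
have kM w : ball c (4 * r) w -> `|re (k * f' w)| <= M /\ `|im (k * f' w)| <= M.
  move=> /fM[f0 f1]; rewrite reM imM /= !mul0r sub0r add0r mulN1r opprK mulN1r.
  by rewrite normrN.
have kE (x y : C) : im (x * y) = re (k * x * y).
  by rewrite -mulrA reM /= mul0r sub0r mulN1r opprK.
have kC (g h : R -> C) : circle_int (fun x => re (k * g x * h x)) = circle_int (fun x => im (g x * h x)).
  by congr circle_int; apply/funext => x; rewrite kE.
rewrite -(kC (fun x => f (circle_pt c r x))) -(kC (fun=> f z)).
exact: (cauchy_re r0 kB kM zr).
Qed.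

Lemma circle_cint_one_neq0 : circle_cint (fun=> 1 : C) != 0.
Proof.
apply/eqP => /(congr1 re) /=.
have c1 : continuous (cst 1 : R -> R) by move=> x; exact: cvg_cst.
have := circle_int_derive c1 (is_derive_affine 0 1); rewrite /cst => ->.
rewrite !add0r mul0r subr0 mulr1 => /eqP.
by rewrite mulf_eq0 pnatr_eq0/= gt_eqF// pi_gt0.
Qed.

(** Removal of a singularity. Write the kernel of Cauchy's formula as
[1 + (z - c) / (w - z)]. With [p] the restriction of [f] to the circle, the
formula reads [cint p + (z - c) * I p z = f z * L z], where [cint] is the
integral over the circle, [I] is [cauchy_int1] and [L z = cint 1 + (z - c) * I 1 z]. As
[f c = 0] the first term vanishes, and [L c] does not; so [I p / L] is the
quotient. No value of the integral [L] is needed, only that it is nonzero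
at [c]. *)
Lemma holo_div_zero f c : holo_at f c -> f c = 0 ->
  exists2 k, holo_at k c & \forall z \near c, f z = (cplx z - cplx c) * k z.
Proof.
move=> hf fc0; have [cf0 cf1] := holo_at_ccont hf; case: hf => f' ff'.
have [_ [cf'0 cf'1]] := nbhs_singleton ff'.
(* Continuity at [c] bounds [f'] by [M] and [f] by 2 on a ball of radius [4 * r]. *)
pose M := Num.max (`|re (f' c)| + 1) (`|im (f' c)| + 1).
have /nbhs_ballP[rho /= rho0 cB] : \forall w \near c,
    [/\ has_cderiv f f' w /\ ccont f' w, `|re (f' w)| <= M /\ `|im (f' w)| <= M &
     normc (f w) <= 2].
  near=> w; split; first by near: w.
    have h0 : `|re (f' c) - re (f' w)| <= 1.
      by near: w; move/cvgrPdist_le : cf'0; exact.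
    have h1 : `|im (f' c) - im (f' w)| <= 1.
      by near: w; move/cvgrPdist_le : cf'1; exact.
    rewrite /M !le_max -!lerBlDl.
    split; apply/orP; [left|right].
      by rewrite (le_trans (lerB_dist _ _))// distrC.
    by rewrite (le_trans (lerB_dist _ _))// distrC.
  have h0 : `|re (f c) - re (f w)| <= 1.
    by near: w; move/cvgrPdist_le : cf0; exact.
  have h1 : `|im (f c) - im (f w)| <= 1.
    by near: w; move/cvgrPdist_le : cf1; exact.
  rewrite fc0 /= !sub0r !normrN in h0 h1.
  by apply: (le_trans (normc_le _)); rewrite [2]splitr; lra.
pose r := rho / 4; have r0 : 0 < r by rewrite divr_gt0.
have rE : 4 * r = rho by rewrite /r; field.
rewrite -{}rE in cB.
have fB w : ball c (4 * r) w -> has_cderiv f f' w /\ ccont f' w by move=> /cB[].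
have fM w : ball c (4 * r) w -> `|re (f' w)| <= M /\ `|im (f' w)| <= M by move=> /cB[].
have cc : ball c (r / 2) c by apply: ballxx; rewrite divr_gt0.
pose p x := f (circle_pt c r x).
have onE x : (c.1 + 1 * (c.1 + r * cos x - c.1), c.2 + 1 * (c.2 + r * sin x - c.2)) =
    circle_pt c r x by congr (_, _); ring.
have t1 : -1 < (1 : R) < 2 by lra.
have cp : ccontT p.
  move=> x; have [+ _] := ccont_angular r0 fB cc x t1.
  by under eq_fun do rewrite onE.
have pB x : normc (p x) <= 2.
  have := segment_in_ball r0 cc x t1; rewrite onE => /cB[]//.
have c1 : ccontT (fun=> 1 : C) by exact: ccontT_cst.
have n1 (x : R) : normc (1 : C) <= 1 by rewrite normc1.
(* [L] is the left-hand side of the formula for the constant function 1. *)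
pose L z := circle_cint (fun=> 1 : C) + (cplx z - cplx c) * cauchy_int1 (fun=> 1) c r z.
have split_kernel (q : R -> C) z : ccontT q -> ball c (r / 2) z ->
    circle_cint (fun x => q x * (circle_vec r x / (circle_vec r x - (cplx z - cplx c)))) =
    circle_cint q + (cplx z - cplx c) * cauchy_int1 q c r z.
  move=> cq zr; have cD := ccontTM cq (ccontT_denV r0 zr).
  rewrite /cauchy_int1 -(circle_cintZ _ cD) -(circle_cintD cq (ccontTM (ccontT_cst _) cD)).
  congr circle_cint; apply/funext => x; have := den_neq0 r0 x zr => d0.
  by field.
have key z : ball c (r / 2) z -> circle_cint p + (cplx z - cplx c) * cauchy_int1 p c r z = f z * L z.
  move=> zr; rewrite -split_kernel// (cauchy_circle r0 fB fM zr) /L -split_kernel//.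
  by congr (_ * circle_cint _); apply/funext => x; rewrite mul1r.
have p0 : circle_cint p = 0 by have := key _ cc; rewrite fc0 mul0r subrr mul0r addr0.
have hL : holo_at L c.
  apply: holo_atD; first exact: holo_at_cst.
  apply: holo_atM; last by have := @cauchy_int1_holo _ (fun=> 1) c r 1 r0 c1 n1.
  by apply: holo_atD; [exact: holo_at_cplx|exact: holo_at_cst].
have L0 : L c != 0 by rewrite /L subrr mul0r addr0 circle_cint_one_neq0.
exists (fun z => cauchy_int1 p c r z * (L z)^-1).
  apply: holo_atM; first by have := @cauchy_int1_holo _ p c r 2 r0 cp pB.
  exact: holo_atV.
near=> z; have zr : ball c (r / 2) z by near: z; apply: nbhsx_ballx; rewrite divr_gt0.
have Lz : L z != 0 by near: z; exact: (ccont_neq0 (holo_at_ccont hL) L0).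
by rewrite mulrA -[X in X / _]add0r -p0 key// mulfK.
Unshelve. all: by end_near. Qed.

End Division.

(** * The complex exponential series *)

Section CExp.
Variable R : realType.
Local Notation C := (R[i]).

Definition cexp (z : C) : C :=
  Complex (expR (re z) * cos (im z)) (expR (re z) * sin (im z)).

Definition exp_psum (F : numFieldType) (z : F) n : F := \sum_(0 <= i < n) z ^+ i / i`!%:R.

(** The terms of the product of two partial sums whose total degree is at least
[n]. Its coefficients are nonnegative, so it is dominated by its value at the
moduli. *)
Definition exp_psum_tail (F : numFieldType) (a b : F) n : F :=
  \sum_(0 <= i < n) \sum_(n - i <= j < n) (a ^+ j / j`!%:R) * (b ^+ i / i`!%:R).

Lemma exp_psumM (F : numFieldType) (a b : F) n :
  exp_psum a n * exp_psum b n = exp_psum (a + b) n + exp_psum_tail a b n.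
Proof.
(* Group the binomial expansion by the exponent of [b]: a triangular sum. *)
have -> : exp_psum (a + b) n = \sum_(0 <= i < n) \sum_(0 <= j < n - i)
    (a ^+ j / j`!%:R) * (b ^+ i / i`!%:R).
  transitivity (\sum_(0 <= m < n) \sum_(0 <= i < n | (i <= m)%N)
      (a ^+ (m - i) / (m - i)`!%:R) * (b ^+ i / i`!%:R)).
    rewrite /exp_psum !big_nat; apply: eq_bigr => m /andP[_ mn].
    rewrite exprDn mulr_suml -(big_mkord xpredT (fun i =>
      a ^+ (m - i) * b ^+ i *+ 'C(m, i) / m`!%:R)).
    rewrite (big_nat_widen _ _ n)//; apply: eq_big => // i /=.
    rewrite ltnS => im; rewrite -(bin_fact im) -mulr_natr !natrM.
    have f0 k : k`!%:R != 0 :> F by rewrite pnatr_eq0 -lt0n fact_gt0.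
    have b0 : 'C(m, i)%:R != 0 :> F by rewrite pnatr_eq0 -lt0n bin_gt0.
    by field; rewrite !f0 b0.
  rewrite (exchange_big_dep_nat xpredT)//=; apply: eq_big_nat => i /andP[_ ni].
  have -> : \sum_(0 <= m < n | (i <= m)%N) a ^+ (m - i) / (m - i)`!%:R * (b ^+ i / i`!%:R)
     = \sum_(i <= m < n) a ^+ (m - i) / (m - i)`!%:R * (b ^+ i / i`!%:R).
    rewrite (big_nat_widenl i 0)//.
  rewrite -{1}(add0n i) big_addn; apply: eq_bigr => j _.
  by rewrite addnK.
rewrite /exp_psum_tail -big_split/= mulrC [LHS]big_distrl/=.
apply: eq_bigr => i _.
rewrite -big_cat_nat ?leq_subr//= -big_distrl/= mulrC.
by congr (_ * _).
Qed.

Lemma normc_sum (I : Type) (r : seq I) (F : I -> C) :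
  normc (\sum_(i <- r) F i) <= \sum_(i <- r) normc (F i).
Proof.
elim/big_rec2: _ => [|i y x _ xy]; first by rewrite normc0.
by apply: (le_trans (le_normcD _ _)); rewrite lerD2l.
Qed.

Lemma normc_nat n : normc (n%:R : C) = n%:R.
Proof. by rewrite normcMn normc1. Qed.

Lemma exp_psum_tail_le (a b : C) n :
  normc (exp_psum_tail a b n) <= exp_psum_tail (normc a) (normc b) n.
Proof.
apply: (le_trans (normc_sum _ _)); apply: ler_sum => i _.
apply: (le_trans (normc_sum _ _)); apply: ler_sum => j _.
by rewrite !normcM !normcV !normc_nat !normcX.
Qed.

Definition ccvg (s : nat -> C) (l : C) :=
  (fun n => re (s n)) @ \oo --> re l /\ (fun n => im (s n)) @ \oo --> im l.

Lemma ccvgD s t l m : ccvg s l -> ccvg t m -> ccvg (fun n => s n + t n) (l + m).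
Proof.
move=> [s0 s1] [t0 t1]; split; rewrite ?reD ?imD.
  by under eq_fun do rewrite reD; exact: cvgD.
by under eq_fun do rewrite imD; exact: cvgD.
Qed.

Lemma ccvgM s t l m : ccvg s l -> ccvg t m -> ccvg (fun n => s n * t n) (l * m).
Proof.
move=> [s0 s1] [t0 t1]; split; rewrite ?reM ?imM.
  by under eq_fun do rewrite reM; apply: cvgB; apply: cvgM.
by under eq_fun do rewrite imM; apply: cvgD; apply: cvgM.
Qed.

Lemma ccvg_cst (l : C) : ccvg (fun=> l) l.
Proof. by split; exact: cvg_cst. Qed.

Lemma ccvg0 s (e : nat -> R) : (forall n, normc (s n) <= e n) -> e @ \oo --> (0 : R) ->
  ccvg s 0.
Proof.
move=> se e0; split; apply: norm_cvg0; apply: (squeeze_cvgr _ (cvg_cst (0:R)) e0);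
  apply: nearW => n; rewrite normr_ge0/= (le_trans _ (se n))//.
  exact: normr_re.
exact: normr_im.
Qed.

Lemma exp_psum_real (x : R) : exp_psum x n @[n --> \oo] --> expR x.
Proof. exact: is_cvg_series_exp_coeff. Qed.

Lemma expr_imag (y : R) n : (Complex 0 y) ^+ n =
  Complex ((~~ odd n)%:R * (-1) ^+ n./2 * y ^+ n) ((odd n)%:R * (-1) ^+ n.-1./2 * y ^+ n) :> C.
Proof.
have E2 k : (Complex 0 y) ^+ k.*2 = ((-1) ^+ k * y ^+ k.*2)%:C%C :> C.
  rewrite -!muln2 ![(k * 2)%N]mulnC !exprM -exprMn rmorphXn/=; congr (_ ^+ _).
  by apply: complex_eq; rewrite ?expr2 ?reM ?imM /=; ring.
rewrite -(odd_double_half n); move: (n./2) (odd n) => k [].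
  rewrite add1n /= exprS E2 odd_double doubleK exprS.
  by apply: complex_eq; rewrite ?reM ?imM /=; ring.
rewrite add0n E2 odd_double doubleK.
by apply: complex_eq; rewrite /=; ring.
Qed.

Lemma exp_psum_imag (y : R) : ccvg (exp_psum (Complex 0 y)) (Complex (cos y) (sin y)).
Proof.
split => /=.
  have -> : (fun n => re (exp_psum (Complex 0 y) n)) = series (cos_coeff y).
    apply/funext => n; rewrite /exp_psum /series raddf_sum/=; apply: eq_bigr => i _.
    rewrite expr_imag -(rmorph_nat (real_complex R)) -fmorphV reM /= mulr0 subr0. by rewrite /cos_coeff.
  by rewrite cos.unlock; exact: is_cvg_series_cos_coeff.
have -> : (fun n => im (exp_psum (Complex 0 y) n)) = series (sin_coeff y).
  apply/funext => n; rewrite /exp_psum /series raddf_sum/=; apply: eq_bigr => i _.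
  rewrite expr_imag -(rmorph_nat (real_complex R)) -fmorphV imM /= mulr0 add0r. by rewrite /sin_coeff.
by rewrite sin.unlock; exact: is_cvg_series_sin_coeff.
Qed.

(** By domination it suffices to treat real arguments, for which the tail is a
difference of two sequences converging to the same exponential. *)
Lemma exp_psum_tail_cvg (a b : C) : ccvg (exp_psum_tail a b) 0.
Proof.
apply: (ccvg0 (exp_psum_tail_le a b)).
have -> : exp_psum_tail (normc a) (normc b) = (fun n => exp_psum (normc a) n * exp_psum (normc b) n
    - exp_psum (normc a + normc b) n).
  by apply/funext => n; rewrite exp_psumM addrAC subrr add0r.
have -> : (0 : R) = expR (normc a) * expR (normc b) - expR (normc a + normc b).
  by rewrite expRD subrr.
by apply: cvgB; [apply: cvgM|]; exact: exp_psum_real.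
Qed.

(** The series is split along real and imaginary parts of [z]: the first factor is
the real exponential, the second one gives the cosine and sine series. *)
Lemma exp_psum_cvg (z : C) : ccvg (exp_psum z) (cexp z).
Proof.
have zE : z = (re z)%:C%C + Complex 0 (im z).
  by apply: complex_eq; rewrite ?reD ?imD /= ?addr0 ?add0r.
have -> : exp_psum z = (fun n => exp_psum (re z)%:C%C n * exp_psum (Complex 0 (im z)) n +
    - 1 * exp_psum_tail (re z)%:C%C (Complex 0 (im z)) n).
  by apply/funext => n; rewrite exp_psumM -zE mulN1r addrK.
have -> : cexp z = (expR (re z))%:C%C * Complex (cos (im z)) (sin (im z)) + - 1 * 0.
  by rewrite mulr0 addr0; apply: complex_eq; rewrite ?reM ?imM /=; ring.
apply: ccvgD; last by apply: ccvgM; [exact: ccvg_cst|exact: exp_psum_tail_cvg].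
apply: ccvgM; last exact: exp_psum_imag.
have E n : exp_psum (re z)%:C%C n = (exp_psum (re z) n)%:C%C.
  rewrite /exp_psum rmorph_sum/=; apply: eq_bigr => i _.
  by rewrite rmorphM fmorphV rmorphXn /= rmorph_nat.
split => /=; under eq_fun do rewrite E /=; first exact: exp_psum_real.
exact: cvg_cst.
Qed.

Lemma cexpD (a b : C) : cexp (a + b) = cexp a * cexp b.
Proof.
apply: complex_eq; rewrite /cexp ?reM ?imM ?reD ?imD /= expRD ?cosD ?sinD; ring.
Qed.

Lemma cexp_neq0 (z : C) : cexp z != 0.
Proof.
apply/eqP => z0; have : cexp (z + - z) = 0 by rewrite cexpD z0 mul0r.
rewrite subrr => /(congr1 re) /=.
by rewrite expR0 cos0 mulr1 => /eqP; rewrite oner_eq0.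
Qed.

End CExp.

(** * Powers and exponentials of complexified quaternions *)

Section ExpCoeff.
Variable R : realType.
Local Notation C := (R[i]).

(** The powers of [x + V], where [V] squares to the central element [s], are
[a + b V]; these are the coefficients [(a, b)]. *)
Fixpoint power_coefs (x s : C) (n : nat) : C * C :=
  if n is m.+1 then (x * (power_coefs x s m).1 + s * (power_coefs x s m).2, (power_coefs x s m).1 + x * (power_coefs x s m).2)
  else (1, 0).

(** [x + sg] is an eigenvalue of multiplication by [x + V] when [sg] is a square
root of [s]. *)
Lemma power_coefs_eigen (x s sg : C) n : sg ^+ 2 = s ->
  (power_coefs x s n).1 + sg * (power_coefs x s n).2 = (x + sg) ^+ n.
Proof.
move=> <-; elim: n => [|n IH] /=; first by rewrite mulr0 addr0.
by rewrite [RHS]exprS -IH; ring.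
Qed.

Lemma power_coefs_nil (x : C) n : power_coefs x 0 n = (x ^+ n, n%:R * x ^+ n.-1).
Proof.
elim: n => [|n IH] /=; first by rewrite mul0r.
rewrite IH /= mul0r addr0 -exprS; congr (_, _).
case: n {IH} => [|n]; first by rewrite !mul0r mulr0 addr0 mul1r.
by rewrite /= exprS -[n.+2]add1n natrD; ring.
Qed.

Definition coef_psum1 x s n : C := \sum_(0 <= i < n) (power_coefs x s i).1 / i`!%:R.
Definition coef_psum2 x s n : C := \sum_(0 <= i < n) (power_coefs x s i).2 / i`!%:R.

Lemma coef_psum_eigen (x s sg : C) n : sg ^+ 2 = s ->
  coef_psum1 x s n + sg * coef_psum2 x s n = exp_psum (x + sg) n.
Proof.
move=> sgs; rewrite /coef_psum1 /coef_psum2 mulr_sumr -big_split/=; apply: eq_bigr => i _.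
by rewrite -(power_coefs_eigen x i sgs) mulrA mulrDl.
Qed.

(** With [sg] a square root of [s], the combinations [A + sg * B] and [A - sg * B]
are the exponentials of [x + sg] and [x - sg], whose product is the square of
the exponential of [x]. For [s = 0] the eigenvalues coincide, and the second
coefficient is obtained from a shift of the exponential series. *)
Lemma exp_coefs_cvg (x s : C) : exists A B : C,
  [/\ ccvg (coef_psum1 x s) A, ccvg (coef_psum2 x s) B,
      A ^+ 2 - s * B ^+ 2 = cexp x ^+ 2 & s = 0 -> A = cexp x].
Proof.
have [->|s0] := eqVneq s 0.
  exists (cexp x), (cexp x); split => //; last by rewrite mul0r subr0.
    have -> : coef_psum1 x 0 = exp_psum x; last exact: exp_psum_cvg.
    by apply/funext => n; apply: eq_bigr => i _; rewrite power_coefs_nil.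
  have E n : coef_psum2 x 0 n.+1 = exp_psum x n.
    elim: n => [|n IH]; first by rewrite /coef_psum2 /exp_psum big_nat1 big_nil power_coefs_nil !mul0r.
    rewrite /coef_psum2 big_nat_recr// power_coefs_nil -/(coef_psum2 _ _ _) IH /exp_psum big_nat_recr//=.
    congr (_ + _); rewrite factS natrM.
    have f0 k : k`!%:R != 0 :> C by rewrite pnatr_eq0 -lt0n fact_gt0.
    by field; rewrite f0 nat1r pnatr_eq0.
  have [c0 c1] := exp_psum_cvg x.
  by split; rewrite -cvg_shiftS /=; under eq_fun do rewrite E.
pose sg := sqrtc s; have sgs : sg ^+ 2 = s by exact: sqr_sqrtc.
have sg0 : sg != 0 by rewrite -sqrf_eq0 sgs.
have sgs' : (- sg) ^+ 2 = s by rewrite sqrrN.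
exists ((cexp (x + sg) + cexp (x - sg)) * 2^-1),
  ((cexp (x + sg) + - 1 * cexp (x - sg)) * (2 * sg)^-1); split.
- have -> : coef_psum1 x s = (fun n => (exp_psum (x + sg) n + exp_psum (x - sg) n) * 2^-1).
    by apply/funext => n; rewrite -(coef_psum_eigen _ _ sgs) -(coef_psum_eigen _ _ sgs'); field.
  by apply: ccvgM; [apply: ccvgD; exact: exp_psum_cvg|exact: ccvg_cst].
- have -> : coef_psum2 x s = (fun n => (exp_psum (x + sg) n + - 1 * exp_psum (x - sg) n) * (2 * sg)^-1).
    by apply/funext => n; rewrite -(coef_psum_eigen _ _ sgs) -(coef_psum_eigen _ _ sgs'); field.
  apply: ccvgM; last exact: ccvg_cst.
  by apply: ccvgD; [|apply: ccvgM; first exact: ccvg_cst]; exact: exp_psum_cvg.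
- have e2 : cexp x ^+ 2 = cexp (x + sg) * cexp (x - sg).
    by rewrite -cexpD expr2 -cexpD; congr cexp; ring.
  rewrite e2 -sgs; field.
  by rewrite sg0.
- by move=> se; rewrite se eqxx in s0.
Qed.

End ExpCoeff.

(** * Evaluation of stem values and the star exponential *)

Section QuatExp.
Variable R : realType.
Local Notation C := (R[i]).
Local Notation H := (quat R).
Implicit Types (I J : H).

(** The embedding of the complex numbers into the quaternions with image the slice
plane of [I]. *)
Definition slice_emb I (c : C) : H := re c *: 1 + im c *: I.
(** The value at a point of the slice of [I] of a function whose stem has complex
coordinates [c0 + c1 i + c2 j + c3 k], an element of the complexified
quaternions. *)
Definition stem_eval I (c0 c1 c2 c3 : C) : H :=
  slice_emb I c0 + slice_emb I c1 * ei R + slice_emb I c2 * ej R + slice_emb I c3 * ek R.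

Lemma imag_unitsP I : imag_units I ->
  qre I = 0 /\ qi I ^+ 2 + qj I ^+ 2 + qk I ^+ 2 = 1.
Proof.
rewrite /imag_units/= expr2 => I2.
have e0 := congr1 (@qre R) I2; have e1 := congr1 (@qi R) I2.
have e2 := congr1 (@qj R) I2; have e3 := congr1 (@qk R) I2.
rewrite !qcoordE in e0 e1 e2 e3.
have re0 : qre I = 0.
  apply/eqP; apply/negPn/negP => r0.
  have i0 : qi I = 0 by apply: (mulfI r0); lra.
  have j0 : qj I = 0 by apply: (mulfI r0); lra.
  have k0 : qk I = 0 by apply: (mulfI r0); lra.
  rewrite i0 j0 k0 in e0.
  have := sqr_ge0 (qre I); rewrite expr2; lra.
by split => //; rewrite re0 in e0; lra.
Qed.

Lemma slice_embM I (a b : C) : imag_units I -> slice_emb I (a * b) = slice_emb I a * slice_emb I b.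
Proof.
move=> I2; rewrite /slice_emb mulrDl !mulrDr -!scalerAl -!scalerAr !mul1r mulr1.
rewrite -[I * I]expr2 I2 reM imM.
by apply: quat_ext; rewrite !qcoordE; ring.
Qed.

Lemma slice_embD I (a b : C) : slice_emb I (a + b) = slice_emb I a + slice_emb I b.
Proof. by rewrite /slice_emb reD imD !scalerDl addrACA. Qed.

Lemma stem_evalM I (k c0 c1 c2 c3 : C) : imag_units I ->
  slice_emb I k * stem_eval I c0 c1 c2 c3 = stem_eval I (k * c0) (k * c1) (k * c2) (k * c3).
Proof.
move=> I2; rewrite /stem_eval !slice_embM//.
by move: (slice_emb I k) (slice_emb I c0) (slice_emb I c1) (slice_emb I c2) => a b0 b1 b2;
  move: (slice_emb I c3) => b3; rewrite !mulrDr !mulrA.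
Qed.

Lemma stem_evalD I (a0 a1 a2 a3 b0 b1 b2 b3 : C) :
  stem_eval I a0 a1 a2 a3 + stem_eval I b0 b1 b2 b3 = stem_eval I (a0 + b0) (a1 + b1) (a2 + b2) (a3 + b3).
Proof.
rewrite /stem_eval !slice_embD; move: (slice_emb I a0) (slice_emb I a1) (slice_emb I a2) (slice_emb I a3) => x0 x1 x2 x3.
move: (slice_emb I b0) (slice_emb I b1) (slice_emb I b2) (slice_emb I b3) => y0 y1 y2 y3.
rewrite !mulrDl [LHS]addrACA; congr (_ + _).
by rewrite [LHS]addrACA; congr (_ + _); rewrite [LHS]addrACA.
Qed.

Lemma stem_eval_congr I (c0 c1 c2 c3 d0 d1 d2 d3 : C) :
  c0 = d0 -> c1 = d1 -> c2 = d2 -> c3 = d3 -> stem_eval I c0 c1 c2 c3 = stem_eval I d0 d1 d2 d3.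
Proof. by move=> -> -> -> ->. Qed.

Lemma stem_eval_stem I (p q : H) : p + I * q =
  stem_eval I (Complex (qre p) (qre q)) (Complex (qi p) (qi q)) (Complex (qj p) (qj q)) (Complex (qk p) (qk q)).
Proof. by apply: quat_ext; rewrite /stem_eval /slice_emb /ei /ej /ek !qcoordE /=; ring. Qed.

Lemma slice_embN I (a : C) : slice_emb I (- a) = - slice_emb I a.
Proof. by rewrite /slice_emb reN imN !scaleNr opprD. Qed.

Lemma mul_ei : [/\ ei R * ei R = -1, ej R * ei R = - ek R & ek R * ei R = ej R].
Proof. by split; apply: quat_ext; rewrite /ei /ej /ek !qcoordE; ring. Qed.
Lemma mul_ej : [/\ ei R * ej R = ek R, ej R * ej R = -1 & ek R * ej R = - ei R].
Proof. by split; apply: quat_ext; rewrite /ei /ej /ek !qcoordE; ring. Qed.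
Lemma mul_ek : [/\ ei R * ek R = - ej R, ej R * ek R = ei R & ek R * ek R = -1].
Proof. by split; apply: quat_ext; rewrite /ei /ej /ek !qcoordE; ring. Qed.

Lemma stem_eval_ei I c0 c1 c2 c3 : stem_eval I c0 c1 c2 c3 * ei R = stem_eval I (- c1) c0 c3 (- c2).
Proof.
have [ii ji ki] := mul_ei; rewrite /stem_eval !slice_embN.
move: (slice_emb I c0) (slice_emb I c1) (slice_emb I c2) (slice_emb I c3) => p0 p1 p2 p3.
rewrite !mulrDl -!mulrA ii ji ki !mulrN mulr1 mulNr.
by rewrite [p0 * _ + _]addrC [LHS]addrAC.
Qed.

Lemma stem_eval_ej I c0 c1 c2 c3 : stem_eval I c0 c1 c2 c3 * ej R = stem_eval I (- c2) (- c3) c0 c1.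
Proof.
have [ij jj kj] := mul_ej; rewrite /stem_eval !slice_embN.
move: (slice_emb I c0) (slice_emb I c1) (slice_emb I c2) (slice_emb I c3) => p0 p1 p2 p3.
rewrite !mulrDl -!mulrA ij jj kj !mulrN mulr1 mulNr.
by rewrite -[LHS]addrA [LHS]addrC addrA.
Qed.

Lemma stem_eval_ek I c0 c1 c2 c3 : stem_eval I c0 c1 c2 c3 * ek R = stem_eval I (- c3) c2 (- c1) c0.
Proof.
have [ik jk kk] := mul_ek; rewrite /stem_eval !slice_embN.
move: (slice_emb I c0) (slice_emb I c1) (slice_emb I c2) (slice_emb I c3) => p0 p1 p2 p3.
rewrite !mulrDl -!mulrA ik jk kk !mulrN mulr1 mulNr.
by rewrite [LHS]addrC [p0 * _ + _ + _]addrC [p0 * _ + _]addrC !addrA.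
Qed.

(** The square of a vector [V] of the complexified quaternions is the scalar
[- (v1^2 + v2^2 + v3^2)]; here [V] multiplies [x + V]. *)
Lemma stem_eval_vecM I (x v1 v2 v3 : C) : imag_units I -> let c := stem_eval I x v1 v2 v3 in
  slice_emb I v1 * (c * ei R) + slice_emb I v2 * (c * ej R) + slice_emb I v3 * (c * ek R) =
  stem_eval I (- (v1 ^+ 2 + v2 ^+ 2 + v3 ^+ 2)) (x * v1) (x * v2) (x * v3).
Proof.
move=> I2 c; have sum3 (a0 a1 a2 a3 b0 b1 b2 b3 c0 c1 c2 c3 : C) :
    stem_eval I a0 a1 a2 a3 + stem_eval I b0 b1 b2 b3 + stem_eval I c0 c1 c2 c3 =
    stem_eval I (a0 + b0 + c0) (a1 + b1 + c1) (a2 + b2 + c2) (a3 + b3 + c3) by rewrite !stem_evalD.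
rewrite /c stem_eval_ei stem_eval_ej stem_eval_ek !(stem_evalM _ _ _ _ _ I2).
by apply: (etrans (sum3 _ _ _ _ _ _ _ _ _ _ _ _)); apply: stem_eval_congr; ring.
Qed.

Lemma qunit_neq0 (c : H) : c != 0 -> c \is a GRing.unit.
Proof. by []. Qed.

(** Conjugation by [c] moves the point [a + I b] on its sphere; the new imaginary
unit is intertwined with [I] by [c]. This turns the star product into the
product of stems. *)
Lemma conj_slice I (c : H) (a b : R) : imag_units I -> c != 0 ->
  [/\ imag_units (c^-1 * I * c), c * (c^-1 * I * c) = I * c &
      c^-1 * (a%:A + I * b%:A) * c = a%:A + (c^-1 * I * c) * b%:A].
Proof.
move=> I2 /qunit_neq0 c0; split.
- rewrite /imag_units/= expr2 !mulrA mulrK// -[_ * I * I]mulrA -expr2 I2.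
  by rewrite mulrN1 mulNr mulVr.
- by rewrite !mulrA mulrV// mul1r.
- have := mulVr c0; move: (c^-1) => d dc.
  by rewrite mulrDr mulrDl -!(scalerAr, scalerAl) !mulr1 dc.
Qed.

Lemma qnorm_imag I (b : R) : imag_units I -> qnorm (b *: I) = `|b|.
Proof.
move=> /imag_unitsP[I0 I1]; rewrite /qnorm !qcoordE I0 -sqrtr_sqr; congr Num.sqrt.
rewrite mulr0 expr0n/= add0r !exprMn -!mulrDr I1 mulr1//.
Qed.

Lemma circular_slice (Omega : set H) I J (a b : R) : circular Omega ->
  imag_units I -> imag_units J -> Omega (a%:A + I * b%:A) -> Omega (a%:A + J * b%:A).
Proof.
move=> cO I2 J2 OI; apply: (cO _ OI).
have [I0 _] := imag_unitsP I2.
have re_a : qre (a%:A + I * b%:A) = a by rewrite !qcoordE I0; ring.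
have -> : qsphere (a%:A + I * b%:A) = [set a%:A + `|b| *: K | K in @imag_units R].
  rewrite /qsphere re_a /qvec re_a addrC addKr -scalerAr mulr1.
  by rewrite qnorm_imag.
have [b0|b0] := leP 0 b.
  by exists J => //; rewrite ger0_norm// -scalerAr mulr1.
exists (- J); first by rewrite /imag_units/= sqrrN.
by rewrite ltr0_norm// -scalerAr mulr1 scaleNr scalerN opprK.
Qed.

Lemma starX_stem_eval (Omega : set H) (f : H -> H) (a b : R) (x v1 v2 v3 : C) : circular Omega ->
  (forall I, imag_units I -> Omega (a%:A + I * b%:A) -> f (a%:A + I * b%:A) = stem_eval I x v1 v2 v3) ->
  forall n I, imag_units I -> Omega (a%:A + I * b%:A) ->
  let s := - (v1 ^+ 2 + v2 ^+ 2 + v3 ^+ 2) in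
  starX f n (a%:A + I * b%:A) =
  stem_eval I (power_coefs x s n).1 ((power_coefs x s n).2 * v1) ((power_coefs x s n).2 * v2) ((power_coefs x s n).2 * v3).
Proof.
move=> cO fE n; elim: n => [|n IH] I I2 OI s /=.
  rewrite /stem_eval /slice_emb !mul0r /= !scale0r !addr0 !mul0r !addr0 scale1r.
  by [].
move: IH; cbv zeta; rewrite -/s; move: (power_coefs x s n) => [y z] /= IH.
rewrite /star fE//; set c := stem_eval I x v1 v2 v3.
(* The right-hand side is the product [(y + z V) * (x + V)], evaluated at [I]. *)
have E : slice_emb I y * c + slice_emb I z * (slice_emb I v1 * (c * ei R) + slice_emb I v2 * (c * ej R) +
    slice_emb I v3 * (c * ek R)) =
    stem_eval I (x * y + s * z) ((y + x * z) * v1) ((y + x * z) * v2) ((y + x * z) * v3).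
  rewrite (stem_eval_vecM _ _ _ _ I2) !(stem_evalM _ _ _ _ _ I2).
  by apply: (etrans (stem_evalD _ _ _ _ _ _ _ _ _)); apply: stem_eval_congr; rewrite /s; ring.
rewrite -E; clearbody c; case: eqVneq => [->|c0].
  by rewrite !(mul0r, mulr0, addr0).
have [J2 cJ ->] := conj_slice a b I2 c0.
set J := c^-1 * I * c in J2 cJ *.
rewrite IH//; last exact: circular_slice OI.
have cev k : c * slice_emb J k = slice_emb I k * c.
  by rewrite /slice_emb mulrDr mulrDl -!(scalerAr, scalerAl) mulr1 mul1r cJ.
have := cev (z * v3); have := cev (z * v2); have := cev (z * v1); have := cev y.
rewrite /stem_eval !(slice_embM z _ I2); move: (slice_emb J y) (slice_emb J (z * v1)) (slice_emb J (z * v2)) (slice_emb J (z * v3)).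
move: (slice_emb I y) (slice_emb I z) (slice_emb I v1) (slice_emb I v2) (slice_emb I v3) => y' z' w1 w2 w3 j0 j1 j2 j3 e0 e1 e2 e3.
by rewrite !mulrDr !mulrA e0 e1 e2 e3 !addrA.
Qed.

Lemma stem_eval_cvg I (s0 s1 s2 s3 : nat -> C) (l0 l1 l2 l3 : C) :
  ccvg s0 l0 -> ccvg s1 l1 -> ccvg s2 l2 -> ccvg s3 l3 ->
  (fun n => stem_eval I (s0 n) (s1 n) (s2 n) (s3 n)) @ \oo --> stem_eval I l0 l1 l2 l3.
Proof.
move=> h0 h1 h2 h3.
have cv (e : H) s l : ccvg s l -> (fun n => slice_emb I (s n) * e) @ \oo --> slice_emb I l * e.
  move=> [r i]; rewrite /slice_emb mulrDl -!scalerAl.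
  under eq_fun do rewrite mulrDl -!scalerAl.
  by apply: (@cvgD _ (quat R)); exact: cvgZr_tmp.
rewrite /stem_eval; apply: (@cvgD _ (quat R)); last exact: cv.
apply: (@cvgD _ (quat R)); last exact: cv.
apply: (@cvgD _ (quat R)); last exact: cv.
by have := cv 1 _ _ h0; under eq_fun do rewrite mulr1; rewrite mulr1.
Qed.

(** On stems the star exponential is the exponential of the complexified
quaternions, so at each point it has the form [A + B V], with norm the square of
the exponential of the scalar part. *)
Lemma exp_star_stem_eval (Omega : set H) (f : H -> H) (a b : R) (x v1 v2 v3 : C) : circular Omega ->
  (forall I, imag_units I -> Omega (a%:A + I * b%:A) -> f (a%:A + I * b%:A) = stem_eval I x v1 v2 v3) ->
  exists A B : C,
  [/\ forall I, imag_units I -> Omega (a%:A + I * b%:A) ->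
        exp_star f (a%:A + I * b%:A) = stem_eval I A (B * v1) (B * v2) (B * v3),
      A ^+ 2 + (v1 ^+ 2 + v2 ^+ 2 + v3 ^+ 2) * B ^+ 2 = cexp x ^+ 2 &
      v1 ^+ 2 + v2 ^+ 2 + v3 ^+ 2 = 0 -> A = cexp x].
Proof.
move=> cO fE; set N := v1 ^+ 2 + v2 ^+ 2 + v3 ^+ 2.
have [A [B [cA cB AB A0]]] := exp_coefs_cvg x (- N).
exists A, B; split => [I I2 OI||N0].
- rewrite /exp_star; apply: cvg_lim; first exact: norm_hausdorff.
  have -> : series (fun n => (n`!%:R : R)^-1 *: starX f n (a%:A + I * b%:A)) =
    (fun n => stem_eval I (coef_psum1 x (- N) n) (coef_psum2 x (- N) n * v1) (coef_psum2 x (- N) n * v2)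
       (coef_psum2 x (- N) n * v3)).
    apply/funext => n; rewrite /series /=; elim: n => [|n IH].
      rewrite big_nil /coef_psum1 /coef_psum2 !big_nil !mul0r /stem_eval /slice_emb /=.
      by rewrite !scale0r !addr0 !mul0r !addr0.
    rewrite big_nat_recr//= IH (starX_stem_eval cO fE n I2 OI) -/N.
    rewrite /coef_psum1 /coef_psum2 !(@big_nat_recr _ _ _ n 0)//= -/(coef_psum1 _ _ _) -/(coef_psum2 _ _ _).
    have kE : (n`!%:R : R)^-1 *: (1 : H) = slice_emb I (n`!%:R)^-1.
      rewrite -(rmorph_nat (real_complex R)) -fmorphV /slice_emb /=.
      by rewrite scale0r addr0.
    rewrite -mulr_algl kE (stem_evalM _ _ _ _ _ I2).
    by apply: (etrans (stem_evalD _ _ _ _ _ _ _ _ _)); apply: stem_eval_congr; ring.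
  by apply: stem_eval_cvg => //; apply: ccvgM => //; exact: ccvg_cst.
- by rewrite -AB mulNr opprK.
- by apply: A0; rewrite N0 oppr0.
Qed.

End QuatExp.

(** * Slices, stem domains and circular sets *)

Section Stems.
Variable R : realType.
Local Notation C := (R[i]).
Local Notation H := (quat R).
Implicit Types (I J q : H) (Omega : set H) (z w : R * R).

Lemma imag_ei : imag_units (ei R).
Proof. by apply: quat_ext; rewrite expr2 /ei !qcoordE; ring. Qed.
Lemma imag_ej : imag_units (ej R).
Proof. by apply: quat_ext; rewrite expr2 /ej !qcoordE; ring. Qed.
Lemma imag_N I : imag_units I -> imag_units (- I).
Proof. by move=> I2; rewrite /imag_units/= sqrrN. Qed.

Lemma polar q : exists I, exists2 b : R, imag_units I & q = (qre q)%:A + I * b%:A.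
Proof.
pose n := qnorm (qvec q).
have [n0|n0] := eqVneq n 0.
  exists (ei R), 0; first exact: imag_ei.
  move/eqP: n0; rewrite -sqrf_eq0 qnorm2_eq0 subr_eq0 => /eqP e.
  by rewrite scale0r mulr0 addr0.
exists (n^-1 *: qvec q), n; last first.
  by rewrite -scalerAl -scalerAr mulr1 scalerA mulVf// scale1r /qvec addrC subrK.
rewrite /imag_units/= expr2 -scalerAl -scalerAr scalerA.
have -> : qvec q * qvec q = - (n ^+ 2)%:A.
  by rewrite qnorm2E; apply: quat_ext; rewrite /qvec !qcoordE; ring.
by rewrite scalerN scalerA -invfM -expr2 mulVf ?scale1r// sqrf_eq0.
Qed.

Lemma slice_coords I (a b : R) : imag_units I ->
  [/\ qre (a%:A + I * b%:A) = a, qvec (a%:A + I * b%:A) = b *: I,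
      qnorm (qvec (a%:A + I * b%:A)) = `|b| &
      qnorm (a%:A + I * b%:A) ^+ 2 = a ^+ 2 + b ^+ 2].
Proof.
move=> I2; have [I0 I1] := imag_unitsP I2.
have re_a : qre (a%:A + I * b%:A) = a by rewrite !qcoordE I0; ring.
have vE : qvec (a%:A + I * b%:A) = b *: I.
  by rewrite /qvec re_a addrC addKr -scalerAr mulr1.
split => //; first by rewrite vE qnorm_imag.
rewrite qnorm2E -[b ^+ 2]mulr1 -I1 !qcoordE I0; ring.
Qed.

Lemma stem_domP Omega I z : circular Omega -> imag_units I ->
  stem_domain Omega z <-> Omega (z.1%:A + I * z.2%:A).
Proof.
move=> cO I2; split=> [[J J2 OJ]|OI]; last by exists I.
exact: circular_slice OJ.
Qed.

Lemma stem_conj Omega z : stem_domain Omega z -> stem_domain Omega (z.1, - z.2).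
Proof.
move=> [I I2 OI]; exists (- I); first exact: imag_N.
by rewrite /= scaleNr mulrNN.
Qed.

Lemma quat_coord_continuous (i : 'I_4) : continuous (fun q : H => (q : 'rV[R]_4) 0 i).
Proof. exact: (@coord_continuous _ 1 4 0 i). Qed.

Lemma stem_open Omega : circular Omega -> open Omega -> open (stem_domain Omega).
Proof.
move=> cO oO.
have -> : stem_domain Omega = (fun z : R * R => z.1 *: (1 : H) + z.2 *: ei R) @^-1` Omega.
  apply/seteqP; split => z /=.
    by move=> /(stem_domP z cO imag_ei); rewrite -scalerAr mulr1.
  by move=> Oz; apply/(stem_domP z cO imag_ei); rewrite -scalerAr mulr1.
apply: open_comp => // z _.
apply: (@cvgD _ (quat R)); apply: cvgZr_tmp.
  exact: cvg_fst.
exact: cvg_snd.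
Qed.

(** The stem domain is the image of a slice under linear coordinates. *)
Lemma stem_connected Omega : circular Omega -> slice_contractible Omega ->
  connected (stem_domain Omega).
Proof.
move=> cO [I I2 [[_ _ _ cS] _]].
have [I0 I1] := imag_unitsP I2.
pose p q : R * R := (qre q, qi q * qi I + qj q * qj I + qk q * qk I).
have pE (a b : R) : p (a%:A + I * b%:A) = (a, b).
  rewrite /p !qcoordE I0; congr (_, _); first by ring.
  have e : b = b * (qi I ^+ 2 + qj I ^+ 2 + qk I ^+ 2) by rewrite I1 mulr1.
  by rewrite [RHS]e; ring.
have -> : stem_domain Omega = p @` slice Omega I.
  apply/seteqP; split => z.
    move=> /(stem_domP z cO I2) Oz; exists (z.1%:A + I * z.2%:A).
      by split => //; exists z.1, z.2; rewrite -scalerAr mulr1.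
    by rewrite pE; case: z {Oz}.
  move=> [q [Oq [a [b qE]]] <-].
  have qE' : q = a%:A + I * b%:A by rewrite qE -scalerAr mulr1.
  by rewrite qE' pE; apply/(stem_domP _ cO I2); rewrite -qE'.
apply: connected_continuous_connected => //.
apply: continuous_subspaceT => q.
have cc i : {for q, continuous (fun q : H => (q : 'rV[R]_4) 0 i)} := @quat_coord_continuous i q.
have E : p x @[x --> q] --> (nbhs (p q).1, nbhs (p q).2); last exact: E.
apply: cvg_pair; [exact: (nbhs_filter q)|exact: (cc 0)|].
have F : Filter (nbhs q) by exact: nbhs_filter.
apply: (@cvgD R R^o _ (nbhs q) F); first apply: (@cvgD R R^o _ (nbhs q) F).
- by apply: (@cvgM _ _ (nbhs q) F); [exact: (cc 1)|exact: cvg_cst].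
- by apply: (@cvgM _ _ (nbhs q) F); [exact: (cc 2)|exact: cvg_cst].
- by apply: (@cvgM _ _ (nbhs q) F); [exact: (cc 3)|exact: cvg_cst].
Qed.

Definition delta z0 z : C := (cplx z - cplx z0) * (cplx z - cplx (z0.1, - z0.2)).

(** In the complex coordinate, [Delta] is the product of the two linear factors
vanishing at [z0] and at its conjugate. *)
Lemma Delta_slice_emb I I0 (a0 b0 a b : R) : imag_units I -> imag_units I0 ->
  Delta (a0%:A + I0 * b0%:A) (a%:A + I * b%:A) = slice_emb I (delta (a0, b0) (a, b)).
Proof.
move=> I2 I02; have [r0 _ _ n0] := slice_coords a0 b0 I02.
rewrite /Delta r0 n0 /delta.
have -> : (cplx (a, b) - cplx (a0, b0)) * (cplx (a, b) - cplx (a0, - b0)) =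
  cplx (a, b) * cplx (a, b) + Complex (- (2 * a0)) 0 * cplx (a, b) + Complex (a0 ^+ 2 + b0 ^+ 2) 0.
  by apply: complex_eq; rewrite /cplx !(reM, imM, reD, imD, reN, imN) /=; ring.
rewrite !slice_embD !slice_embM//; have -> : slice_emb I (cplx (a, b)) = a%:A + I * b%:A.
  by rewrite /slice_emb /= -scalerAr mulr1.
move: (a%:A + I * b%:A) => q; rewrite expr2 /slice_emb /= !scale0r !addr0.
by rewrite mulr_algl scaleNr.
Qed.

(** Two opposite imaginary units separate the even and odd parts of the stem. *)
Lemma stem_eval_inj (c0 c1 c2 c3 d0 d1 d2 d3 : C) :
  (forall I, imag_units I -> stem_eval I c0 c1 c2 c3 = stem_eval I d0 d1 d2 d3) ->
  [/\ c0 = d0, c1 = d1, c2 = d2 & c3 = d3].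
Proof.
have E I (a0 a1 a2 a3 : C) : stem_eval I a0 a1 a2 a3 =
    Quat (re a0) (re a1) (re a2) (re a3) + I * Quat (im a0) (im a1) (im a2) (im a3).
  rewrite stem_eval_stem !qcoordE.
  by case: a0 a1 a2 a3 => [? ?] [? ?] [? ?] [? ?].
move=> cd; have := cd _ (imag_N imag_ei); have := cd _ imag_ei; rewrite !E !mulNr.
set P := Quat (re c0) _ _ _; set P' := Quat (re d0) _ _ _.
set Q := Quat (im c0) _ _ _; set Q' := Quat (im d0) _ _ _ => e f.
have PP : P = P'.
  have : 2%:R *: P = 2%:R *: P'.
    have -> : 2%:R *: P = (P + ei R * Q) + (P - ei R * Q).
      by rewrite addrACA subrr addr0 scaler_nat mulr2n.
    by rewrite e f addrACA subrr addr0 scaler_nat mulr2n.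
  by move/(congr1 (fun x => 2%:R^-1 *: x)); rewrite !scalerA mulVf ?scale1r// pnatr_eq0.
have QQ : Q = Q'.
  move: e; rewrite PP => /addrI /(congr1 (fun x => - (ei R * x))).
  by rewrite !mulrA -expr2 imag_ei !mulN1r !opprK.
have p (k : H -> R) : k P = k P' by rewrite PP.
have q (k : H -> R) : k Q = k Q' by rewrite QQ.
have := (p (@qre R), p (@qi R), (p (@qj R), p (@qk R))).
have := (q (@qre R), q (@qi R), (q (@qj R), q (@qk R))).
rewrite !qcoordE => -[[i0 i1] [i2 i3]] [[r0 r1] [r2 r3]].
by split; exact: complex_eq.
Qed.

End Stems.

(** * Coordinates of a stem, and division by Delta *)

Section StemHolo.
Variable R : realType.
Local Notation C := (R[i]).
Local Notation H := (quat R).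
Implicit Types (I J q : H) (Omega : set H) (z w : R * R).

(** The four complex coordinates of a stem in the basis 1, i, j, k. *)
Definition stem_coord (i : 'I_4) (F0 F1 : R * R -> H) z : C :=
  Complex ((F0 z : 'rV[R]_4) 0 i) ((F1 z : 'rV[R]_4) 0 i).

Lemma is_derive_coord (i : 'I_4) (F : R * R -> H) z v : derivable F z v ->
  is_derive z v (fun w => (F w : 'rV[R]_4) 0 i) (('D_v F z : 'rV[R]_4) 0 i).
Proof.
move=> dF; apply: DeriveDef.
  by move: dF => /(derivable_mxP (F : R * R -> 'rV[R]_4)); apply.
have -> : 'D_v F z = 'D_v (F : R * R -> 'rV[R]_4) z by [].
by rewrite derive_mx// mxE.
Qed.

Lemma continuous_coord (i : 'I_4) (F : R * R -> H) z : {for z, continuous F} ->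
  {for z, continuous (fun w => (F w : 'rV[R]_4) 0 i)}.
Proof.
move=> cF; exact: (@continuous_comp _ _ _ F (fun q => (q : 'rV[R]_4) 0 i) z cF
  (@quat_coord_continuous R i (F z))).
Qed.

Lemma holo_stem_coord (i : 'I_4) Omega (F0 F1 : R * R -> H) z :
  open (stem_domain Omega) -> regular_stem Omega F0 F1 -> stem_domain Omega z ->
  holo_at (stem_coord i F0 F1) z.
Proof.
move=> oD [C0 C1 _ cr] Dz.
exists (stem_coord i (fun w => 'D_(1, 0) F0 w) (fun w => 'D_(1, 0) F1 w)).
have : \forall w \near z, stem_domain Omega w by exact: open_nbhs_nbhs.
apply: filterS => w Dw.
have [a1 a2 a3 a4] := C0 _ Dw; have [b1 b2 b3 b4] := C1 _ Dw.
have [e1 e2] := cr _ Dw.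
split; last first.
  have ca := @continuous_coord i (fun w => 'D_(1, 0) F0 w) w a3.
  have cb := @continuous_coord i (fun w => 'D_(1, 0) F1 w) w b3.
  split; [exact ca|exact cb].
split; split => /=.
- exact: (is_derive_coord i a1).
- by have := is_derive_coord i a2; rewrite e2 mxE.
- exact: (is_derive_coord i b1).
- by have := is_derive_coord i b2; rewrite -e1.
Qed.

(** Replaces the identity theorem: identities established after multiplication by
a power of [delta z0] hold away from [z0], and extend to [z0] by continuity. *)
Lemma punctured_eq0 (d : R * R -> C) z : ccont d z ->
  (\forall w \near z, w != z -> d w = 0) -> d z = 0.
Proof.
move=> cd dz; apply/eqP/negPn/negP => dz0.
have : \forall w \near z, w = z.
  near=> w; apply/eqP/negPn/negP => wz.
  have d0 : d w != 0 by near: w; exact: (ccont_neq0 cd dz0).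
  move/eqP: d0; apply; move: wz; near: w; exact: dz.
move=> /nbhs_ballP[e /= e0 ez].
have /ez/(congr1 fst)/= /eqP : ball z e (z.1 + e / 2, z.2).
  apply/ball_pairE; split => /=; last by rewrite subrr normr0.
  by rewrite opprD addNKr normrN gtr0_norm ?divr_gt0//; lra.
by rewrite -subr_eq0 addrAC subrr add0r gt_eqF// divr_gt0.
Unshelve. all: by end_near. Qed.

Lemma reJ (x : C) : re (x^*)%C = re x. Proof. by case: x. Qed.
Lemma imJ (x : C) : im (x^*)%C = - im x. Proof. by case: x. Qed.

Lemma conjcM (x y : C) : ((x * y)^*)%C = (x^*)%C * (y^*)%C.
Proof. by apply: complex_eq; rewrite ?(reM, imM, reJ, imJ) ?(reM, imM); ring. Qed.

Lemma ccont_conj (T : topologicalType) (f : T -> C) t :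
  ccont f t -> ccont (fun s => (f s)^*%C) t.
Proof.
move=> [f0 f1]; split.
  by under [X in {for _, continuous X}]eq_fun do rewrite reJ.
by under [X in {for _, continuous X}]eq_fun do rewrite imJ; exact: cvgN.
Qed.

Definition conj_pt z : R * R := (z.1, - z.2).

Lemma conj_pt_continuous : continuous conj_pt.
Proof.
move=> z; have E : conj_pt w @[w --> z] --> (nbhs z.1, nbhs (- z.2)); last exact: E.
by apply: cvg_pair; [exact: cvg_fst|apply: cvgN; exact: cvg_snd].
Qed.

Lemma conj_ptK : involutive conj_pt.
Proof. by case=> a b; rewrite /conj_pt /= opprK. Qed.

Lemma cplx_inj z w : cplx z = cplx w -> z = w.
Proof. by case: z w => [a b] [c d] [-> ->]. Qed.

Lemma cplxB_neq0 z w : z != w -> cplx z - cplx w != 0.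
Proof. by apply: contraNneq => /subr0_eq/cplx_inj ->. Qed.

Lemma delta_neq0 z0 z : z != z0 -> z != conj_pt z0 -> delta z0 z != 0.
Proof. by move=> h1 h2; rewrite mulf_neq0// cplxB_neq0. Qed.

Lemma delta_conj_pt z0 z : delta z0 (conj_pt z) = (delta z0 z)^*%C.
Proof.
by case: z z0 => a b [c d]; apply: complex_eq; rewrite /delta /conj_pt /cplx /=; ring.
Qed.

Lemma near_neq z w : z != w -> \forall z' \near z, z' != w.
Proof.
move=> /cplxB_neq0 zw; have hd : holo_at (fun z' => cplx z' - cplx w) z.
  by apply: holo_atD; [exact: holo_at_cplx|exact: holo_at_cst].
apply: filterS (ccont_neq0 (holo_at_ccont hd) zw) => z'.
by apply: contraNneq => ->; rewrite subrr.
Qed.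

Lemma holo_at_delta z0 z : holo_at (delta z0) z.
Proof.
have hd w : holo_at (fun z' => cplx z' - cplx w) z.
  by apply: holo_atD; [exact: holo_at_cplx|exact: holo_at_cst].
exact: (holo_atM (hd _) (hd _)).
Qed.

(** The quotient [h / delta z0] is holomorphic away from [z0] and its conjugate;
near each of these two points it is given by [holo_div_zero]. Compatibility with
conjugation is clear away from the two points and extends by continuity. *)
Lemma holo_divide (D : set (R * R)) (h : R * R -> C) z0 : open D ->
  (forall z, D z -> D (conj_pt z)) -> (forall z, D z -> holo_at h z) ->
  (forall z, D z -> h (conj_pt z) = (h z)^*%C) -> D z0 -> z0.2 != 0 -> h z0 = 0 ->
  exists k : R * R -> C, [/\ forall z, D z -> holo_at k z,
    forall z, D z -> k (conj_pt z) = (k z)^*%C & forall z, D z -> h z = delta z0 z * k z].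
Proof.
move=> oD Dbar hh hbar Dz0 z02 hz0.
have nz : z0 != conj_pt z0.
  apply/eqP => /(congr1 snd)/= e; move/eqP: z02; apply; lra.
have nz' : conj_pt z0 != z0 by rewrite eq_sym.
have hz0' : h (conj_pt z0) = 0 by rewrite hbar// hz0 rmorph0.
have [k1 hk1 e1] := holo_div_zero (hh _ Dz0) hz0.
have [k2 hk2 e2] := holo_div_zero (hh _ (Dbar _ Dz0)) hz0'.
(* At the two zeros the value is the one of the local quotients. *)
pose k z := if z == z0 then k1 z0 / (cplx z0 - cplx (conj_pt z0)) else
  if z == conj_pt z0 then k2 (conj_pt z0) / (cplx (conj_pt z0) - cplx z0) else h z / delta z0 z.
have k_out z : z != z0 -> z != conj_pt z0 -> k z = h z / delta z0 z.
  by move=> /negbTE a /negbTE b; rewrite /k a b.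
have near1 : \forall z \near z0, k z = k1 z * (cplx z - cplx (conj_pt z0))^-1.
  near=> z; rewrite /k; case: eqVneq => [->//|zz0].
  have zb : z != conj_pt z0 by near: z; exact: near_neq.
  rewrite (negbTE zb) (_ : h z = (cplx z - cplx z0) * k1 z); last by near: z.
  rewrite /delta -/(conj_pt z0); have := cplxB_neq0 zz0; have := cplxB_neq0 zb => a b.
  by field; rewrite a b.
have near2 : \forall z \near conj_pt z0, k z = k2 z * (cplx z - cplx z0)^-1.
  near=> z; rewrite /k.
  have zz0 : z != z0 by near: z; exact: near_neq.
  rewrite (negbTE zz0); case: eqVneq => [->//|zb].
  rewrite (_ : h z = (cplx z - cplx (conj_pt z0)) * k2 z); last by near: z.
  rewrite /delta -/(conj_pt z0); have := cplxB_neq0 zz0; have := cplxB_neq0 zb => a b.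
  by field; rewrite a b.
have hk z : D z -> holo_at k z.
  move=> Dz; have [->|zz0] := eqVneq z z0.
    apply: (@holo_at_eq _ (fun z => k1 z * (cplx z - cplx (conj_pt z0))^-1)).
      by apply: filterS near1 => ? ->.
    apply: holo_atM => //; apply: holo_atV; first exact: cplxB_neq0.
    by apply: holo_atD; [exact: holo_at_cplx|exact: holo_at_cst].
  have [->|zb] := eqVneq z (conj_pt z0).
    apply: (@holo_at_eq _ (fun z => k2 z * (cplx z - cplx z0)^-1)).
      by apply: filterS near2 => ? ->.
    apply: holo_atM => //; apply: holo_atV; first exact: cplxB_neq0.
    by apply: holo_atD; [exact: holo_at_cplx|exact: holo_at_cst].
  apply: (@holo_at_eq _ (fun z => h z * (delta z0 z)^-1)).
    near=> w; rewrite k_out//.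
      by near: w; exact: near_neq.
    by near: w; exact: near_neq.
  apply: holo_atM; first exact: hh.
  by apply: holo_atV; [exact: delta_neq0|exact: holo_at_delta].
have kbar_out z : D z -> z != z0 -> z != conj_pt z0 -> k (conj_pt z) = (k z)^*%C.
  move=> Dz a b; rewrite !k_out//.
    by rewrite hbar// delta_conj_pt conjcM conjc_inv.
    by rewrite -(inj_eq (can_inj conj_ptK)) conj_ptK.
  by rewrite (inj_eq (can_inj conj_ptK)).
have kbar0 z : D z -> (\forall w \near z, w != z -> w != z0 /\ w != conj_pt z0) ->
    k (conj_pt z) = (k z)^*%C.
  move=> Dz zz; apply/eqP; rewrite -subr_eq0; apply/eqP.
  apply: (@punctured_eq0 (fun z => k (conj_pt z) - (k z)^*%C)).
    have [c0 c1] := holo_at_ccont (hk _ Dz).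
    have [c2 c3] := holo_at_ccont (hk _ (Dbar _ Dz)).
    apply: ccontD; last first.
      by apply: ccontN; apply: ccont_conj.
    by split; [exact: (@continuous_comp _ _ _ conj_pt (fun w => re (k w)) z (@conj_pt_continuous z) c2)|
      exact: (@continuous_comp _ _ _ conj_pt (fun w => im (k w)) z (@conj_pt_continuous z) c3)].
  have Dn : \forall w \near z, D w by exact: open_nbhs_nbhs.
  near=> w => wz; have [] : w != z0 /\ w != conj_pt z0 by move: wz; near: w.
  by move=> a b; rewrite kbar_out ?subrr//; near: w.
exists k; split => //.
- move=> z Dz; have [->|zz0] := eqVneq z z0.
    apply: kbar0 => //; near=> w => ->; split => //.
    by near: w; exact: near_neq.
  have [->|zb] := eqVneq z (conj_pt z0).
    apply: kbar0 => //; first exact: Dbar.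
    near=> w => ->; split => //.
    by near: w; exact: near_neq.
  exact: kbar_out.
- move=> z Dz; have [->|zz0] := eqVneq z z0.
    by rewrite hz0 /delta subrr !mul0r.
  have [->|zb] := eqVneq z (conj_pt z0).
    by rewrite hz0' /delta -/(conj_pt z0) subrr mulr0 mul0r.
  by rewrite k_out// mulrC divfK// delta_neq0.
Unshelve. all: by end_near. Qed.

End StemHolo.

(** * Stems from holomorphic coordinates *)

Section StemDivide.
Variable R : realType.
Local Notation C := (R[i]).
Local Notation H := (quat R).
Implicit Types (I J q : H) (Omega : set H) (z w : R * R).

(** A quaternion from its four real coordinates. *)
Definition row_stem (p : 'I_4 -> R) : H := \row_i p i.

Lemma near_eq_continuous (T U : topologicalType) (f g : T -> U) (t : T) :
  (\forall s \near t, f s = g s) -> {for t, continuous f} -> {for t, continuous g}.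
Proof.
move=> fg; rewrite /prop_for /continuous_at -(nbhs_singleton fg); apply: cvg_trans.
exact: near_eq_cvg.
Qed.

Lemma continuous_row (p : 'I_4 -> R * R -> R) z :
  (forall i, {for z, continuous (p i)}) -> {for z, continuous (fun w => row_stem (p ^~ w))}.
Proof.
move=> cp; apply/(@cvgrPdist_le R 'rV[R]_4) => e e0; near=> x.
rewrite /Num.Def.normr/= mx_normrE (bigmax_le _ (ltW e0))//= => i _.
rewrite !mxE/=; move: i; near: x; apply: filter_forall => i.
by have /cvgrPdist_le := cp i.2; exact.
Unshelve. all: by end_near. Qed.

Lemma is_derive_row (p : 'I_4 -> R * R -> R) (d : 'I_4 -> R) z v :
  (forall i, is_derive z v (p i) (d i)) ->
  is_derive z v (fun w => row_stem (p ^~ w)) (row_stem d).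
Proof.
move=> dp; pose F w : 'rV[R]_4 := \row_i p i w.
have E a i : (fun w => F w a i) = p i by apply/funext => w; rewrite mxE.
have D : derivable F z v.
  by apply/derivable_mxP => a i; rewrite E; case: (dp i).
have V : 'D_v F z = \row_i d i.
  by rewrite derive_mx//; apply/rowP => i; rewrite !mxE E; case: (dp i).
exact: (@DeriveDef _ _ _ _ _ _ _ D V).
Qed.

Lemma regular_row_stem Omega (h : 'I_4 -> R * R -> C) : open (stem_domain Omega) ->
  (forall i z, stem_domain Omega z -> holo_at (h i) z) ->
  (forall i z, stem_domain Omega z -> h i (conj_pt z) = (h i z)^*%C) ->
  regular_stem Omega (fun w => row_stem (fun i => re (h i w)))
    (fun w => row_stem (fun i => im (h i w))).
Proof.
move=> oD hh hbar.
have loc z : stem_domain Omega z -> exists h' : 'I_4 -> R * R -> C,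
    \forall w \near z, forall i, has_cderiv (h i) (h' i) w /\ ccont (h' i) w.
  move=> Dz; have /choice[h' hh'] : forall i, exists h', \forall w \near z,
      has_cderiv (h i) h' w /\ ccont h' w by move=> i; exact: hh.
  exists h'; exact: (@filter_forall _ _ (fun i w => has_cderiv (h i) (h' i) w /\ ccont (h' i) w) (nbhs z) (nbhs_filter z) hh').
have ders z : stem_domain Omega z -> exists h' : 'I_4 -> R * R -> C,
    (forall i, ccont (h' i) z) /\ \forall w \near z,
  [/\ is_derive (w : R * R) (1, 0) (fun w => row_stem (fun i => re (h i w))) (row_stem (fun i => re (h' i w))),
      is_derive (w : R * R) (0, 1) (fun w => row_stem (fun i => re (h i w))) (row_stem (fun i => - im (h' i w))),
      is_derive (w : R * R) (1, 0) (fun w => row_stem (fun i => im (h i w))) (row_stem (fun i => im (h' i w))) &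
      is_derive (w : R * R) (0, 1) (fun w => row_stem (fun i => im (h i w))) (row_stem (fun i => re (h' i w)))].
  move=> /loc[h' lh]; exists h'; split.
    by move=> i; have [] := nbhs_singleton lh i.
  apply: filterS lh => w lw; split.
  - by apply: (@is_derive_row (fun i w => re (h i w))) => i; have [[[? ?] [? ?]] _] := lw i.
  - by apply: (@is_derive_row (fun i w => re (h i w))) => i; have [[[? ?] [? ?]] _] := lw i.
  - by apply: (@is_derive_row (fun i w => im (h i w))) => i; have [[[? ?] [? ?]] _] := lw i.
  - by apply: (@is_derive_row (fun i w => im (h i w))) => i; have [[[? ?] [? ?]] _] := lw i.
split.
- move=> z /ders[h' [ch' dz]]; have [d1 d2 _ _] := nbhs_singleton dz.
  split; [by case: d1|by case: d2| |].
    apply: (@near_eq_continuous _ _ (fun w => row_stem (fun i => re (h' i w)))).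
      by apply: filterS dz => w [e _ _ _]; rewrite (@derive_val _ _ _ _ _ _ _ e).
    by apply: (@continuous_row (fun i w => re (h' i w))) => i; have [] := ch' i.
  apply: (@near_eq_continuous _ _ (fun w => row_stem (fun i => - im (h' i w)))).
    by apply: filterS dz => w [_ e _ _]; rewrite (@derive_val _ _ _ _ _ _ _ e).
  by apply: (@continuous_row (fun i w => - im (h' i w))) => i; apply: cvgN; have [] := ch' i.
- move=> z /ders[h' [ch' dz]]; have [_ _ d1 d2] := nbhs_singleton dz.
  split; [by case: d1|by case: d2| |].
    apply: (@near_eq_continuous _ _ (fun w => row_stem (fun i => im (h' i w)))).
      by apply: filterS dz => w [_ _ e _]; rewrite (@derive_val _ _ _ _ _ _ _ e).
    by apply: (@continuous_row (fun i w => im (h' i w))) => i; have [] := ch' i.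
  apply: (@near_eq_continuous _ _ (fun w => row_stem (fun i => re (h' i w)))).
    by apply: filterS dz => w [_ _ _ e]; rewrite (@derive_val _ _ _ _ _ _ _ e).
  by apply: (@continuous_row (fun i w => re (h' i w))) => i; have [] := ch' i.
- move=> z Dz; split; apply/rowP => i; rewrite !mxE -/(conj_pt z) hbar// ?reJ ?imJ//.
- move=> z /ders[h' [ch' dz]]; have [d1 d2 d3 d4] := nbhs_singleton dz.
  rewrite (@derive_val _ _ _ _ _ _ _ d1) (@derive_val _ _ _ _ _ _ _ d2) (@derive_val _ _ _ _ _ _ _ d3) (@derive_val _ _ _ _ _ _ _ d4); split => //.
  by apply/rowP => i; rewrite !mxE.
Qed.

End StemDivide.

(** * Star logarithms at an isolated zero of the vector part *)

Section Log.
Variable R : realType.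
Local Notation C := (R[i]).
Local Notation H := (quat R).
Implicit Types (I J q : H) (Omega : set H) (z w : R * R).

Lemma stem_eval_stem_coord I (F0 F1 : R * R -> H) z : F0 z + I * F1 z =
  stem_eval I (stem_coord 0 F0 F1 z) (stem_coord 1 F0 F1 z)
       (stem_coord 2 F0 F1 z) (stem_coord 3 F0 F1 z).
Proof. exact: stem_eval_stem. Qed.

Lemma stem_coord_bar (i : 'I_4) Omega (F0 F1 : R * R -> H) z :
  regular_stem Omega F0 F1 -> stem_domain Omega z ->
  stem_coord i F0 F1 (conj_pt z) = (stem_coord i F0 F1 z)^*%C.
Proof.
move=> [_ _ sym _] Dz; have [e0 e1] := sym _ Dz.
by rewrite /stem_coord /conj_pt e0 e1 mxE.
Qed.

Lemma ord4P (P : 'I_4 -> Prop) : P 0 -> P 1 -> P 2 -> P 3 -> forall i, P i.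
Proof.
move=> p0 p1 p2 p3 [[|[|[|[|//]]]] Hi].
- by rewrite (_ : Ordinal Hi = 0)//; exact: val_inj.
- by rewrite (_ : Ordinal Hi = 1)//; exact: val_inj.
- by rewrite (_ : Ordinal Hi = 2)//; exact: val_inj.
- by rewrite (_ : Ordinal Hi = 3)//; exact: val_inj.
Qed.

(** The function induced by a stem, evaluated through the polar form of [q] with
nonnegative imaginary part. At a real point the quotient by [n = 0] is harmless
since odd parts vanish there. *)
Definition stem_fun (K0 K1 : R * R -> H) q : H :=
  let n := qnorm (qvec q) in K0 (qre q, n) + (n^-1 *: qvec q) * K1 (qre q, n).

Lemma induced_stem_fun Omega (K0 K1 : R * R -> H) :
  regular_stem Omega K0 K1 -> Defs.induced Omega K0 K1 (stem_fun K0 K1).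
Proof.
move=> [_ _ sym _] I a b I2 OI; have [re_q v_q n_q _] := slice_coords a b I2.
rewrite /stem_fun re_q n_q v_q scalerA.
have Dab : stem_domain Omega (a, b) by exists I.
have [/= s0 s1] := sym _ Dab.
have [b0|b0|b0] := ltgtP b 0.
- by rewrite ltr0_norm// s0 s1 invrN mulNr mulVf ?lt_eqF// scaleN1r mulrNN.
- by rewrite gtr0_norm// mulVf ?gt_eqF// scale1r.
- have K10 : K1 (a, b) = 0.
    move: s1; rewrite b0 oppr0 => /eqP; rewrite -addr_eq0 => /eqP e.
    have : 2 *: K1 (a, 0) = 0 :> H by rewrite scaler_nat mulr2n.
    by move/eqP; rewrite scaler_eq0 pnatr_eq0/= => /eqP.
  by move: K10; rewrite b0 normr0 => ->; rewrite !mulr0.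
Qed.

(** If all coordinates of the stem of the cofactor vanish at [z0], one more factor
[Delta] can be extracted, coordinate by coordinate. *)
Lemma Delta_factor_succ Omega (gv ft : H -> H) (m : nat) (T0 T1 : R * R -> H) I0 (a0 b0 : R) :
  circular Omega -> open Omega -> imag_units I0 -> b0 != 0 ->
  Omega (a0%:A + I0 * b0%:A) ->
  Delta_factor Omega (a0%:A + I0 * b0%:A) gv m ft ->
  regular_stem Omega T0 T1 -> Defs.induced Omega T0 T1 ft ->
  (forall i, stem_coord i T0 T1 (a0, b0) = 0) ->
  exists gt, Delta_factor Omega (a0%:A + I0 * b0%:A) gv m.+1 gt.
Proof.
move=> cO oO I02 b00 Oq0 [_ gvE] rT iT T00.
have oD := stem_open cO oO.
have D0 : stem_domain Omega (a0, b0) by exists I0.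
have /choice[k kP] : forall i : 'I_4, exists k : R * R -> C,
    [/\ forall z, stem_domain Omega z -> holo_at k z,
      forall z, stem_domain Omega z -> k (conj_pt z) = (k z)^*%C &
      forall z, stem_domain Omega z -> stem_coord i T0 T1 z = delta (a0, b0) z * k z].
  move=> i; apply: holo_divide => //.
  - by move=> z; exact: stem_conj.
  - by move=> z; exact: holo_stem_coord.
  - by move=> z; exact: stem_coord_bar.
pose K0 z := row_stem (fun i => re (k i z)); pose K1 z := row_stem (fun i => im (k i z)).
have rK : regular_stem Omega K0 K1.
  by apply: regular_row_stem => // i z; have [h1 h2 _] := kP i; [exact: h1|exact: h2].
have iK := induced_stem_fun rK.
exists (stem_fun K0 K1); split; first by exists K0, K1.
move=> q Oq; rewrite gvE// exprSr -mulrA; congr (_ * _).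
have [I [b I2 qE]] := polar q; move: (qre q) qE => a qE; rewrite {}qE in Oq *.
have Dz : stem_domain Omega (a, b) by exists I.
rewrite iT// iK// Delta_slice_emb//.
rewrite (stem_eval_stem_coord I T0 T1 (a, b)) (stem_eval_stem_coord I K0 K1 (a, b)) stem_evalM//.
have kE i : stem_coord i T0 T1 (a, b) = delta (a0, b0) (a, b) * stem_coord i K0 K1 (a, b).
  have [_ _ ->//] := kP i; congr (_ * _).
  by rewrite /stem_coord !mxE; case: (k i (a, b)).
by rewrite !kE.
Qed.

(** The value of a complexified vector at [I] vanishes only if the vector is a
zero divisor, that is, has norm zero: multiply by the vector itself. *)
Lemma stem_eval_eq0_norm I (t1 t2 t3 : C) : imag_units I -> stem_eval I 0 t1 t2 t3 = 0 ->
  t1 ^+ 2 + t2 ^+ 2 + t3 ^+ 2 = 0.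
Proof.
move=> I2 e; have [I0 I1] := imag_unitsP I2.
have := stem_eval_vecM 0 t1 t2 t3 I2; rewrite /= e !(mul0r, mulr0, addr0).
set N := t1 ^+ 2 + t2 ^+ 2 + t3 ^+ 2 => /esym.
rewrite /stem_eval /slice_emb reN imN /= !scale0r !(mul0r, addr0) => E.
have e0 := congr1 (@qre R) E; have e1 := congr1 (@qi R) E.
have e2 := congr1 (@qj R) E; have e3 := congr1 (@qk R) E.
rewrite !qcoordE I0 in e0 e1 e2 e3.
have r0 : re N = 0 by lra.
have i0 : im N = 0.
  apply/eqP; rewrite -sqrf_eq0; apply/eqP.
  have -> : im N ^+ 2 = (- im N * qi I) ^+ 2 + (- im N * qj I) ^+ 2 + (- im N * qk I) ^+ 2.
    by rewrite !exprMn sqrrN -!mulrDr I1 mulr1.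
  have -> : - im N * qi I = 0 by lra.
  have -> : - im N * qj I = 0 by lra.
  have -> : - im N * qk I = 0 by lra.
  by rewrite expr0n/= !addr0.
exact: complex_eq.
Qed.

(** A vector parallel to a nonzero null vector is null. *)
Lemma parallel_null (f1 f2 f3 t1 t2 t3 : C) :
  f1 * t2 = f2 * t1 -> f1 * t3 = f3 * t1 -> f2 * t3 = f3 * t2 ->
  t1 ^+ 2 + t2 ^+ 2 + t3 ^+ 2 = 0 -> ~ (t1 = 0 /\ t2 = 0 /\ t3 = 0) ->
  f1 ^+ 2 + f2 ^+ 2 + f3 ^+ 2 = 0.
Proof.
move=> e12 e13 e23 N0 nz.
have key (t f : C) : t != 0 ->
    t ^+ 2 * (f1 ^+ 2 + f2 ^+ 2 + f3 ^+ 2) = f ^+ 2 * (t1 ^+ 2 + t2 ^+ 2 + t3 ^+ 2) ->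
    f1 ^+ 2 + f2 ^+ 2 + f3 ^+ 2 = 0.
  move=> t0; rewrite N0 mulr0 => /eqP; rewrite mulf_eq0 sqrf_eq0 (negbTE t0)/=.
  by move/eqP.
have sq (a b c d : C) : a * b = c * d -> a ^+ 2 * b ^+ 2 = c ^+ 2 * d ^+ 2.
  by move=> e; rewrite -!exprMn e.
move/sq in e12; move/sq in e13; move/sq in e23.
have [t10|t10] := eqVneq t1 0; last first.
  by apply: (key t1 f1) => //; rewrite !mulrDr e12 e13; ring.
have [t20|t20] := eqVneq t2 0; last first.
  by apply: (key t2 f2) => //; rewrite !mulrDr e23 -e12; ring.
have [t30|t30] := eqVneq t3 0; last first.
  by apply: (key t3 f3) => //; rewrite !mulrDr -e23 -e13; ring.
by case: nz.
Qed.

(** What the existence of a star logarithm says at one point of the stem domain,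
in coordinates. *)
Lemma star_log_coords Omega (g f : H -> H) (F0 F1 : R * R -> H) z (g0 g1 g2 g3 : C) :
  circular Omega -> Defs.induced Omega F0 F1 f ->
  (forall q, Omega q -> exp_star f q = g q) -> stem_domain Omega z ->
  (forall I, imag_units I -> g (z.1%:A + I * z.2%:A) = stem_eval I g0 g1 g2 g3) ->
  [/\ g0 ^+ 2 + (g1 ^+ 2 + g2 ^+ 2 + g3 ^+ 2) = cexp (stem_coord 0 F0 F1 z) ^+ 2,
      exists B, [/\ g1 = B * stem_coord 1 F0 F1 z, g2 = B * stem_coord 2 F0 F1 z &
                    g3 = B * stem_coord 3 F0 F1 z] &
      stem_coord 1 F0 F1 z ^+ 2 + stem_coord 2 F0 F1 z ^+ 2 + stem_coord 3 F0 F1 z ^+ 2 = 0 ->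
      g0 = cexp (stem_coord 0 F0 F1 z)].
Proof.
move=> cO iF fg Dz gE.
have Oz I : imag_units I -> Omega (z.1%:A + I * z.2%:A) by move=> I2; apply/stem_domP.
have fE I : imag_units I -> Omega (z.1%:A + I * z.2%:A) -> f (z.1%:A + I * z.2%:A) =
    stem_eval I (stem_coord 0 F0 F1 z) (stem_coord 1 F0 F1 z) (stem_coord 2 F0 F1 z)
      (stem_coord 3 F0 F1 z).
  by move=> I2 OI; rewrite iF// -stem_eval_stem_coord; case: (z).
have [A [B [eE AB A0]]] := exp_star_stem_eval cO fE.
have [eA e1 e2 e3] : [/\ g0 = A, g1 = B * stem_coord 1 F0 F1 z,
    g2 = B * stem_coord 2 F0 F1 z & g3 = B * stem_coord 3 F0 F1 z].
  apply: stem_eval_inj => I I2; rewrite -gE// -fg ?eE//; exact: Oz.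
split.
- by rewrite eA -AB e1 e2 e3; ring.
- by exists B.
- by rewrite eA.
Qed.

(** The vector part of a star logarithm [f] is parallel to that of [g], hence to the
cofactor [t] away from [z0], and by continuity at [z0]. Since [t] is a nonzero
null vector there, the vector part of [f] is null as well, and the scalar part of
its exponential is the exponential of its scalar part. *)
Lemma star_log_at_zero Omega (g f : H -> H) (F0 F1 : R * R -> H) z0 m
    (g0 g1 g2 g3 t1 t2 t3 : R * R -> C) :
  circular Omega -> open Omega -> regular_stem Omega F0 F1 -> Defs.induced Omega F0 F1 f ->
  (forall q, Omega q -> exp_star f q = g q) -> stem_domain Omega z0 -> z0.2 != 0 ->
  (forall z I, stem_domain Omega z -> imag_units I ->
     g (z.1%:A + I * z.2%:A) = stem_eval I (g0 z) (g1 z) (g2 z) (g3 z)) ->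
  (forall z, stem_domain Omega z ->
     [/\ g1 z = delta z0 z ^+ m * t1 z, g2 z = delta z0 z ^+ m * t2 z &
         g3 z = delta z0 z ^+ m * t3 z]) ->
  [/\ ccont t1 z0, ccont t2 z0 & ccont t3 z0] ->
  t1 z0 ^+ 2 + t2 z0 ^+ 2 + t3 z0 ^+ 2 = 0 -> ~ (t1 z0 = 0 /\ t2 z0 = 0 /\ t3 z0 = 0) ->
  g0 z0 = cexp (stem_coord 0 F0 F1 z0).
Proof.
move=> cO oO rF iF fg D0 z02 gE tE [ct1 ct2 ct3] N0 nz.
have oD := stem_open cO oO.
have nD : \forall z \near z0, stem_domain Omega z by exact: open_nbhs_nbhs.
have nb : \forall z \near z0, z != conj_pt z0.
  by apply: near_neq; apply/eqP => /(congr1 snd)/= e; move/eqP: z02; apply; lra.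
have cF i : ccont (stem_coord i F0 F1) z0.
  by apply: holo_at_ccont; exact: holo_stem_coord rF D0.
have [_ _] := star_log_coords cO iF fg D0 (gE z0 ^~ D0); apply.
have cross i j (a b : R * R -> C) : ccont a z0 -> ccont b z0 ->
    (forall z, stem_domain Omega z -> exists B,
      delta z0 z ^+ m * a z = B * stem_coord i F0 F1 z /\
      delta z0 z ^+ m * b z = B * stem_coord j F0 F1 z) ->
    stem_coord i F0 F1 z0 * b z0 = stem_coord j F0 F1 z0 * a z0.
  move=> ca cb abE; apply/eqP; rewrite -subr_eq0; apply/eqP.
  apply: (@punctured_eq0 _ (fun z => stem_coord i F0 F1 z * b z - stem_coord j F0 F1 z * a z)).
    by apply: ccontD; [exact: ccontM|apply: ccontN; exact: ccontM].
  near=> z => zz0; have [|B [ea eb]] := abE z; first by near: z.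
  have d0 : delta z0 z ^+ m != 0 by rewrite expf_neq0// delta_neq0//; near: z.
  apply: (mulfI d0); rewrite mulr0 mulrBr.
  rewrite mulrCA eb [X in _ - X]mulrCA ea; ring.
apply: (@parallel_null _ _ _ (t1 z0) (t2 z0) (t3 z0)) => //.
- apply: cross => // z Dz; have [_ [B [e1 e2 e3]] _] := star_log_coords cO iF fg Dz (gE z ^~ Dz).
  by have [f1 f2 f3] := tE _ Dz; exists B; rewrite -f1 -f2.
- apply: cross => // z Dz; have [_ [B [e1 e2 e3]] _] := star_log_coords cO iF fg Dz (gE z ^~ Dz).
  by have [f1 f2 f3] := tE _ Dz; exists B; rewrite -f1 -f3.
- apply: cross => // z Dz; have [_ [B [e1 e2 e3]] _] := star_log_coords cO iF fg Dz (gE z ^~ Dz).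
  by have [f1 f2 f3] := tE _ Dz; exists B; rewrite -f2 -f3.
Unshelve. all: by end_near. Qed.

End Log.

(** * Vector parts and the conclusion *)

Section Main.
Variable R : realType.
Local Notation C := (R[i]).
Local Notation H := (quat R).
Implicit Types (I J q : H) (Omega : set H) (z w : R * R).

(** The stem of a slice preserving function is real: its values lie in the
slice planes of i and j, which meet in the real axis. *)
Lemma slice_preserving_coord Omega (f : H -> H) z : circular Omega ->
  slice_preserving Omega f -> stem_domain Omega z ->
  exists a : C, forall I, imag_units I -> f (z.1%:A + I * z.2%:A) = slice_emb I a.
Proof.
move=> cO [[A [B [rf fE]]] fI] Dz.
have Oz I : imag_units I -> Omega (z.1%:A + I * z.2%:A) by move=> I2; apply/stem_domP.
have plane I : imag_units I -> exists a b : R, A z + I * B z = a%:A + b *: I.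
  move=> I2; apply: (fI I I2); exists (z.1%:A + I * z.2%:A).
    by split; [exact: Oz|exists z.1, z.2; rewrite -scalerAr mulr1].
  by rewrite fE//; [case: (z)|exact: Oz].
have [a1 [b1 e1]] := plane _ (imag_ei R); have [a2 [b2 e2]] := plane _ (imag_N (imag_ei R)).
have [a3 [b3 e3]] := plane _ (imag_ej R); have [a4 [b4 e4]] := plane _ (imag_N (imag_ej R)).
have c2 := congr1 (@qj R) e1; have c3 := congr1 (@qk R) e1.
have d2 := congr1 (@qj R) e2; have d3 := congr1 (@qk R) e2.
have k1 := congr1 (@qi R) e3; have k3 := congr1 (@qk R) e3.
have l1 := congr1 (@qi R) e4; have l3 := congr1 (@qk R) e4.
rewrite /ei /ej !qcoordE in c2 c3 d2 d3 k1 k3 l1 l3.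
have AE : A z = (qre (A z))%:A by apply: quat_ext; rewrite !qcoordE; lra.
have BE : B z = (qre (B z))%:A by apply: quat_ext; rewrite !qcoordE; lra.
exists (Complex (qre (A z)) (qre (B z))) => I I2.
rewrite fE//; last exact: Oz.
have -> : (z.1, z.2) = z by case: (z).
by rewrite {1}AE {1}BE /slice_emb /= -scalerAr mulr1.
Qed.

Lemma vector_part_coord Omega (g gv : H -> H) z (g0 g1 g2 g3 : C) : circular Omega ->
  is_vector_part Omega g gv -> stem_domain Omega z ->
  (forall I, imag_units I -> g (z.1%:A + I * z.2%:A) = stem_eval I g0 g1 g2 g3) ->
  forall I, imag_units I -> gv (z.1%:A + I * z.2%:A) = stem_eval I 0 g1 g2 g3.
Proof.
move=> cO [f0 [f1 [f2 [f3 [[p0 p1 p2 p3] gE vE]]]]] Dz gev.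
have [a0 e0] := slice_preserving_coord cO p0 Dz.
have [a1 e1] := slice_preserving_coord cO p1 Dz.
have [a2 e2] := slice_preserving_coord cO p2 Dz.
have [a3 e3] := slice_preserving_coord cO p3 Dz.
have Oz I : imag_units I -> Omega (z.1%:A + I * z.2%:A) by move=> I2; apply/stem_domP.
have [_ -> -> ->] : [/\ g0 = a0, g1 = a1, g2 = a2 & g3 = a3].
  apply: stem_eval_inj => I I2; rewrite -gev// gE; last exact: Oz.
  by rewrite e0// e1// e2// e3//.
move=> I I2; rewrite vE; last exact: Oz.
rewrite gE; last exact: Oz.
rewrite e0// e1// e2// e3// /stem_eval.
have -> : slice_emb I (0 : C) = 0 by rewrite /slice_emb /= !scale0r addr0.
move: (slice_emb I a0) (slice_emb I a1 * ei R) (slice_emb I a2 * ej R) (slice_emb I a3 * ek R) => x x1 x2 x3.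
by rewrite (addrAC _ x3) (addrAC _ x2) (addrAC x) subrr.
Qed.

Lemma cexp_sqr_eq1 (d : C) : cexp d ^+ 2 = 1 -> re (cexp d) = 1 \/ re (cexp d) = -1.
Proof.
move=> /eqP; rewrite sqrf_eq1 => /orP[/eqP ->|/eqP ->]; [left|right] => //=.
Qed.

(** The image of [D] under [u] is an interval contained in {1, -1}. *)
Lemma sign_constant (D : set (R * R)) (u : R * R -> R) z1 z2 : connected D ->
  (forall z, D z -> {for z, continuous u}) -> (forall z, D z -> u z = 1 \/ u z = -1) ->
  D z1 -> D z2 -> u z1 = -1 -> 0 < u z2 -> False.
Proof.
move=> cD cu u1 D1 D2 uz1 uz2.
have cuD : connected (u @` D).
  apply: connected_continuous_connected => //.
  by apply: continuous_in_subspaceT => z /set_mem; exact: cu.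
have /connected_intervalP itv := cuD.
have [z Dz uz0] : (u @` D) 0.
  apply: (itv (u z1) (u z2)); [by exists z1|by exists z2|rewrite uz1; lra].
by case: (u1 _ Dz); rewrite uz0; lra.
Qed.

End Main.

Theorem corollary6p8 (R : realType) (Omega : set (quat R))
  (g gv : quat R -> quat R) :
  circular Omega -> slice_domain Omega -> slice_contractible Omega ->
  slice_regular Omega g ->
  (forall q, Omega q -> g q <> 0) ->
  is_vector_part Omega g gv ->
  (exists q0, nonreal_isolated_zero Omega gv q0) ->
  ~ (exists f, star_logarithm Omega g f) \/
  ~ (exists f, star_logarithm Omega (fun q => - g q) f).
Proof.
move=> cO [[_ oO _] [qr [Oqr [ar _ arE]]]] sO [G0 [G1 [rG iG]]] _ vg [q0 zq0].
apply/not_andP => -[[f [[F0 [F1 [rF iF]]] fg]] [h [[H0 [H1 [rH iH]]] hg]]].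
have [_ _ [Oq0 nreal] [m [ft [dft mmax ft0]]]] := zq0.
have [[T0 [T1 [rT iT]]] gvE] := dft.
have oD := stem_open cO oO.
have [I0 [b0 I02 q0E]] := polar q0; move: (qre q0) q0E => a0 q0E.
have b00 : b0 != 0.
  apply/eqP => b00; apply: nreal; exists a0 => //.
  by rewrite q0E b00 scale0r mulr0 addr0.
rewrite {}q0E in zq0 Oq0 nreal dft mmax ft0 gvE.
pose z0 : R * R := (a0, b0).
have D0 : stem_domain Omega z0 by exists I0.
have Oz I z : stem_domain Omega z -> imag_units I -> Omega (z.1%:A + I * z.2%:A).
  by move=> Dz I2; apply/stem_domP.
pose gc i := stem_coord i G0 G1; pose tc i := stem_coord i T0 T1.
have gE z I : stem_domain Omega z -> imag_units I ->
    g (z.1%:A + I * z.2%:A) = stem_eval I (gc 0 z) (gc 1 z) (gc 2 z) (gc 3 z).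
  by move=> Dz I2; rewrite iG//; [rewrite -stem_eval_stem_coord; case: (z)|exact: Oz].
have ngE z I : stem_domain Omega z -> imag_units I -> - g (z.1%:A + I * z.2%:A) =
    stem_eval I (- gc 0 z) (- gc 1 z) (- gc 2 z) (- gc 3 z).
  move=> Dz I2; rewrite gE// -mulN1r.
  have -> : -1 = slice_emb I (-1 : R[i]) by rewrite /slice_emb /= oppr0 scale0r addr0 scaleN1r.
  by rewrite stem_evalM// !mulN1r.
have tE I z : stem_domain Omega z -> imag_units I ->
    ft (z.1%:A + I * z.2%:A) = stem_eval I (tc 0 z) (tc 1 z) (tc 2 z) (tc 3 z).
  by move=> Dz I2; rewrite iT//; [rewrite -stem_eval_stem_coord; case: (z)|exact: Oz].
(* The cofactor of the vector part, in coordinates: its scalar coordinate is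
   annihilated by the power of [delta]. *)
have gtE z : stem_domain Omega z -> [/\ 0 = delta z0 z ^+ m * tc 0 z,
    gc 1 z = delta z0 z ^+ m * tc 1 z, gc 2 z = delta z0 z ^+ m * tc 2 z &
    gc 3 z = delta z0 z ^+ m * tc 3 z].
  move=> Dz; apply: stem_eval_inj => I I2.
  rewrite -(vector_part_coord cO vg Dz (gE z ^~ Dz) I2) gvE; last exact: Oz.
  rewrite tE// Delta_slice_emb// -stem_evalM//; congr (_ * _).
  have -> : (z.1, z.2) = z by case: (z).
  elim: m {dft mmax gvE} => [|m IH]; last by rewrite !exprS slice_embM// IH.
  by rewrite !expr0 /slice_emb /= scale0r addr0 scale1r.
have ct i : ccont (tc i) z0 by apply: holo_at_ccont; exact: holo_stem_coord rT D0.
have t00 : tc 0 z0 = 0.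
  apply: punctured_eq0 => //.
  have nD : \forall z \near z0, stem_domain Omega z by exact: open_nbhs_nbhs.
  have nb : \forall z \near z0, z != conj_pt z0.
    apply: near_neq; apply/eqP => /(congr1 snd)/= e; move/eqP: b00; apply; lra.
  near=> z => zz0; have [|/esym/eqP + _ _ _] := gtE z; first by near: z.
  rewrite mulf_eq0 expf_eq0 (negbTE (delta_neq0 zz0 _)) ?andbF//=; last by near: z.
  by move/eqP.
(* At [z0] the cofactor is a null vector, nonzero by maximality of [m]. *)
have tN : tc 1 z0 ^+ 2 + tc 2 z0 ^+ 2 + tc 3 z0 ^+ 2 = 0.
  by apply: (@stem_eval_eq0_norm _ I0) => //; rewrite -t00 -tE.
have tnz : ~ (tc 1 z0 = 0 /\ tc 2 z0 = 0 /\ tc 3 z0 = 0).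
  move=> [t1 [t2 t3]].
  have [|gt /mmax] := Delta_factor_succ cO oO I02 b00 Oq0 dft rT iT.
    by apply: ord4P.
  by rewrite ltnn.
(* The scalar part of [g] at [z0] is the exponential of that of [f], and also
   the opposite of the exponential of that of [h]. *)
have eF : gc 0 z0 = cexp (stem_coord 0 F0 F1 z0).
  apply: (star_log_at_zero cO oO rF iF fg D0 b00 gE _ _ tN tnz (m := m)).
    by move=> z /gtE[].
  by [].
have eH : - gc 0 z0 = cexp (stem_coord 0 H0 H1 z0).
  apply: (@star_log_at_zero _ Omega (fun q => - g q) h H0 H1 z0 m _ _ _ _
    (fun z => - tc 1 z) (fun z => - tc 2 z) (fun z => - tc 3 z) cO oO rH iH hg D0 b00 ngE).
  - by move=> z /gtE[_ -> -> ->]; rewrite !mulrN.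
  - by split; exact: ccontN.
  - by rewrite !sqrrN.
  - by move=> [/eqP + [/eqP + /eqP]]; rewrite !oppr_eq0 => /eqP ? /eqP ? /eqP ?; apply: tnz.
(* Both exponentials are square roots of the norm of [g]; their quotient
   [cexp (d z)] is a sign on the stem domain, -1 at [z0] and positive at the real
   point [ar]. *)
pose d z := stem_coord 0 H0 H1 z - stem_coord 0 F0 F1 z.
have dE z : cexp (stem_coord 0 H0 H1 z) = cexp (d z) * cexp (stem_coord 0 F0 F1 z).
  by rewrite -cexpD /d subrK.
have d1 z : stem_domain Omega z -> cexp (d z) ^+ 2 = 1.
  move=> Dz; have [n1 _ _] := star_log_coords cO iF fg Dz (gE z ^~ Dz).
  have [n2 _ _] := star_log_coords cO iH hg Dz (ngE z ^~ Dz).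
  rewrite dE exprMn !sqrrN n1 in n2.
  have c0 : cexp (stem_coord 0 F0 F1 z) ^+ 2 != 0 by rewrite expf_neq0// cexp_neq0.
  by apply: (mulIf c0); rewrite mul1r -n2.
apply: (@sign_constant R (stem_domain Omega) (fun z => re (cexp (d z))) z0 (ar, 0)).
- exact: stem_connected.
- move=> z Dz.
  have cd : ccont d z.
    apply: ccontD; last apply: ccontN; apply: holo_at_ccont.
      exact: holo_stem_coord rH Dz.
    exact: holo_stem_coord rF Dz.
  have [c0 c1] := cd; apply: cvgM.
    exact: (@continuous_comp _ _ _ (fun z => re (d z)) expR z c0 (@continuous_expR _ _)).
  exact: (@continuous_comp _ _ _ (fun z => im (d z)) cos z c1 (@continuous_cos _ _)).
- by move=> z /d1; exact: cexp_sqr_eq1.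
- exact: D0.
- by exists I0 => //=; rewrite scale0r mulr0 addr0 arE.
- have c0 := cexp_neq0 (stem_coord 0 F0 F1 z0).
  have -> : cexp (d z0) = -1.
    by apply: (mulIf c0); rewrite -dE -eH eF mulN1r.
  by rewrite reN.
- have Dr : stem_domain Omega (ar, 0) by exists I0 => //=; rewrite scale0r mulr0 addr0 arE.
  have im0 (K0 K1 : R * R -> quat R) : regular_stem Omega K0 K1 ->
      im (stem_coord 0 K0 K1 (ar, 0)) = 0.
    move=> [_ _ sym _]; have [_ /=] := sym _ Dr; rewrite oppr0.
    move=> /(congr1 (@qre R)); rewrite qreN /qre /=; lra.
  have dr : im (d (ar, 0)) = 0 by rewrite /d imD imN (im0 _ _ rH) (im0 _ _ rF) subrr.
  have -> : re (cexp (d (ar, 0))) = expR (re (d (ar, 0))) * cos (im (d (ar, 0))) by [].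
  by rewrite dr cos0 mulr1 expR_gt0.
Unshelve. all: by end_near. Qed.
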